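(* Escaping points in $\partial U$ are non-accessible from $U$, while points in $\partial U$ having a bounded orbit are all accessible from $U$.
   Context: Let $f(z)=z+e^{-z}$, with $n$-th iterate $f^n$. A Baker domain is a periodic Fatou component on which the iterates converge locally uniformly to $\infty$. Let $U$ be the unique Baker domain of $f$ contained in the strip $S=\{z\in\mathbb{C}: |\mathrm{Im}\,z|\le\pi\}$; it satisfies $f(U)\subset U$ and contains $\mathbb{R}$. $\partial U$ is its boundary in $\mathbb{C}$. A point $z$ is escaping if $f^n(z)\to\infty$, and has a bounded orbit if $\{f^n(z)\}_{n\ge0}$ is bounded. A point $v$ of the boundary of $U$ is accessible from $U$ if there is a path $\gamma\colon[0,1)\to U$ with $\lim_{t\to1}\gamma(t)=v$. *)

(* Defs.v *)
From HB Require Import structures.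
From mathcomp Require Import all_boot all_order all_algebra.
From mathcomp Require Import complex.
From mathcomp Require Import all_classical all_reals all_analysis.
Import Order.TTheory GRing.Theory Num.Theory.
Import numFieldNormedType.Exports.

Set Implicit Arguments.
Unset Strict Implicit.
Unset Printing Implicit Defensive.

Local Open Scope classical_set_scope.
Local Open Scope ring_scope.
Local Open Scope complex_scope.

(* The complex plane is R[i]^o, the field R[i] as a normed module over itself:
   this is the form on which the analysis library infers the topology. The
   norm `|z| is an element of R[i] (with zero imaginary part), and x <= y in
   R[i] means 'Im x = 'Im y and 'Re x <= 'Re y, so comparing a norm with M%:C
   is the usual comparison of real numbers. *)

Section ComplexDynamics.
Variable R : realType.
Local Notation C := (R[i]^o).
Implicit Types (f g : C -> C) (u : nat -> C -> C) (U V W : set C) (z v : C).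

Definition boundary U : set C := closure U `\` interior U.

Definition cvg_locally_uniformly W u g :=
  forall z, W z -> exists2 V : set C, nbhs z V & {uniform V, u @ \oo --> g}.

Definition dvg_locally_uniformly W u :=
  forall z, W z -> exists2 V : set C, nbhs z V &
    forall M : R, \forall n \near \oo, forall w, V w -> M%:C <= `|u n w|.

(* Montel's formulation: a limit function is finite or identically infinity.
   On a connected W and for holomorphic families this is normality with respect
   to the spherical metric, and in fatou_set one can always shrink W to a disc.
   The finite limits g are holomorphic automatically (Weierstrass). *)
Definition normal_family W (F : set (C -> C)) :=
  forall u, (forall k, F (u k)) ->
    exists2 phi : nat -> nat, {homo phi : m n / (m < n)%N} &
      (exists g, cvg_locally_uniformly W (u \o phi) g) \/
      dvg_locally_uniformly W (u \o phi).

Definition fatou_set f : set C :=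
  [set z | exists W : set C,
    [/\ open W, W z & normal_family W (range (fun n => iter n f))]].

Definition fatou_component f U :=
  exists2 z, fatou_set f z & U = connected_component (fatou_set f) z.

Definition periodic_component f U :=
  fatou_component f U /\ exists2 p, (0 < p)%N & iter p f @` U `<=` U.

Definition baker_domain f U :=
  periodic_component f U /\ dvg_locally_uniformly U (fun n => iter n f).

Definition escaping f z := `|iter n f z| @[n --> \oo] --> +oo.

Definition bounded_orbit f z := bounded_set (range (fun n => iter n f z)).

Definition accessible U v :=
  exists gamma : R -> C,
    [/\ {within `[0, 1[, continuous gamma},
        gamma @` `[0, 1[ `<=` U &
        gamma t @[t --> 1^'-] --> v].

Definition cexp z : C :=
  (expR (complex.Re z) * cos (complex.Im z)) +i* (expR (complex.Re z) * sin (complex.Im z)).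

Definition fbaker z : C := z + cexp (- z).

Definition strip : set C := [set z | `|complex.Im z| <= pi].

End ComplexDynamics.

Arguments fbaker R z : clear implicits.
Arguments strip R : clear implicits.

(* Main.v *)
Require Import Defs.
From mathcomp Require Import all_boot all_order all_algebra.
From mathcomp Require Import complex.
From mathcomp Require Import all_classical all_reals all_analysis.
From mathcomp Require Import ring lra.
Import Order.TTheory GRing.Theory Num.Theory.
Import numFieldNormedType.Exports.

(** Write z = x + iy and r = exp(- x), so that f moves z by r exp(- iy).

The domain. The region |y| < pi, r < 2 cos y ([petal]) is where |f'| < 1 in the
strip. There f does not increase |y| and increases x, so the region is forward
invariant and Re f^n -> +oo on it, locally uniformly. Hence the open set [basin]
of the points whose orbit enters the petal lies in the Fatou set; it contains
the real axis. Complex conjugation commutes with f, so it maps a Baker domain in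
the strip to another one; by uniqueness U is symmetric about the real axis.
Being connected, U then meets the axis, hence contains it. On U the iterates
at the multiples of the period stay in the strip and tend to infinity, so their
real parts tend to +oo or to -oo, and the choice is locally constant; thus U is
contained in the basin ([domain_sub_basin]), and f(U) is contained in U. A
boundary point of U is not in the basin, and its orbit stays in the closed strip.

Escaping points. An orbit of the strip that goes to infinity outside the basin
has Re f^n(v) -> - oo. Far to the left in the strip, a point stays in the strip
only if it is close to a line y = 0 or |y| = pi; the first kind jumps to the
right half-plane, the second kind moves further left. If a curve in U landed at
v, then, past some iterate N, its tail would lie far to the left and, by
continuity and because cos y cannot vanish there, on the same side of the
dichotomy as v; so would all of its images, and its points would never enter the
petal ([escaping_not_accessible]).

Bounded orbits. f is univalent on the half-strip 0 < y < pi, because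
Im f' = r sin y > 0 on that convex set, and its image contains the strip
|y| < pi slit along [1, +oo[ ([kepler_surj]). So f has two inverse branches on
the slit strip, into the upper and the lower half-strip. The orbit of v is coded
by the half-strips which it visits, and v is the image of f^n(v) under the
composition of the corresponding n branches ([pullback]). Let [outer] be the open strip
without the part x > 0 of the petal. At the points of a half-plane x <= X that
the map sends into [outer], |f'| > k for some k > 1 ([expansion]). So a curve in
[outer] shrinks by the factor k with every pullback, as long as the pullbacks
stay in the half-plane, which they do if one point of the curve stays close to
the orbit ([pullback_lip]). Put b = - ln (pi / 2). Its preimages in the strip
are b + i pi/2 and b - i pi/2, and the vertical segments from b to these lie in
the basin. A path with one corner joins f^n(v) to b inside [outer], with length
bounded in n; pulling it back n times shows that the n-th pullback of b tends to
v geometrically, and so do the n-th pullbacks of the segments. The latter fit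
together into a curve in the basin which lands at v; it starts on the real axis
and therefore stays in U. *)

Set Implicit Arguments.
Unset Strict Implicit.
Unset Printing Implicit Defensive.

Local Open Scope classical_set_scope.
Local Open Scope ring_scope.
Local Open Scope complex_scope.

(** * Real inequalities, and the map in real coordinates *)

Section Trig.
Variable R : realType.
Implicit Types x y t : R.

Lemma sin_le_id t : 0 <= t -> sin t <= t.
Proof.
rewrite le_eqVlt => /orP[/eqP <-|t0]; first by rewrite sin0.
have [c _] := @MVT R sin cos 0 t t0 (fun x _ => is_derive_sin x)
  (continuous_subspaceT (@continuous_sin R)).
rewrite sin0 !subr0 => ->.
by rewrite ler_piMl ?(ltW t0)// cos_le1.
Qed.

Lemma cos_ge_quad t : 0 <= t -> 1 - t ^+ 2 / 2 <= cos t.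
Proof.
move=> t0.
have -> : cos t = 1 - 2 * sin (t / 2) ^+ 2.
  have -> : cos t = cos (t / 2 + t / 2) by congr cos; field.
  by rewrite cosD; have := cos2Dsin2 (t / 2); lra.
have h0 : 0 <= t / 2 by lra.
have s1 := sin_le_id h0.
have s2 : - (t / 2) <= sin (t / 2).
  have [t4|t4] := leP (t / 2) pi; last by have := sin_geN1 (t/2); have := pi_ge2 R; lra.
  have : 0 <= sin (t / 2) by rewrite sin_ge0_pi// h0.
  lra.
have : 0 <= (t / 2 - sin (t / 2)) * (t / 2 + sin (t / 2)) by rewrite mulr_ge0//; lra.
lra.
Qed.

Lemma ler_cos x y : 0 <= x -> x <= y -> y <= pi -> cos y <= cos x.
Proof.
move=> x0 xy ypi; move: xy; rewrite le_eqVlt => /orP[/eqP -> //|xy].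
by rewrite ltW// ltr_cos// in_itv /= ?ypi ?x0 ?(le_trans x0 (ltW xy))// (le_trans (ltW xy) ypi).
Qed.

Lemma ler_cos_norm x y : `|x| <= `|y| -> `|y| <= pi -> cos y <= cos x.
Proof.
by move=> xy ypi; rewrite -(cos_norm x) -(cos_norm y); apply: ler_cos.
Qed.

Lemma expR_inv_bound t : 0 <= t -> expR (- t) * (1 + t) <= 1.
Proof.
move=> t0; rewrite expRN mulrC ler_pdivrMr ?expR_gt0// mul1r; exact: expR_ge1Dx.
Qed.

End Trig.

Section RealForm.
Variable R : realType.
Implicit Types x y p q a b t : R.

Definition fre x y := x + expR (- x) * cos y.
Definition fim x y := y - expR (- x) * sin y.
(** The derivative 1 - exp(- z) of the map at x + iy is fdre + i fdim. *)
Definition fdre x y := 1 - expR (- x) * cos y.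
Definition fdim x y := expR (- x) * sin y.

(** Mean value theorem for the scalar product of (p, q) with f along a segment.
Complex-valued functions have no mean value theorem; the choice of (p, q) is
what adapts this one to each use. *)
Lemma mean_value_coord p q x y a b : exists2 t, 0 < t < 1 &
  p * (fre (x + a) (y + b) - fre x y) + q * (fim (x + a) (y + b) - fim x y) =
  p * (fdre (x + t * a) (y + t * b) * a - fdim (x + t * a) (y + t * b) * b) +
  q * (fdre (x + t * a) (y + t * b) * b + fdim (x + t * a) (y + t * b) * a).
Proof.
pose g t := p * fre (x + t * a) (y + t * b) + q * fim (x + t * a) (y + t * b).
pose dg t := p * (fdre (x + t * a) (y + t * b) * a - fdim (x + t * a) (y + t * b) * b) +
  q * (fdre (x + t * a) (y + t * b) * b + fdim (x + t * a) (y + t * b) * a).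
have dgP t : is_derive t (1:R) g (dg t).
  rewrite /g /fre /fim.
  have h1 : is_derive t (1:R) (fun t : R => x + t * a) a.
    by apply: is_derive_eq; rewrite /GRing.scale /=; ring.
  have h2 : is_derive t (1:R) (fun t : R => y + t * b) b.
    by apply: is_derive_eq; rewrite /GRing.scale /=; ring.
  have h3 : is_derive t (1:R) (fun t : R => expR (- (x + t * a))) (expR (- (x + t * a)) * - a).
    apply: (@is_derive1_comp R (@expR R) (fun t => - (x + t * a))).
  have h4 : is_derive t (1:R) (fun t : R => cos (y + t * b)) (- sin (y + t * b) * b).
    exact: (@is_derive1_comp R (@cos R) (fun t => (y + t * b))).
  have h5 : is_derive t (1:R) (fun t : R => sin (y + t * b)) (cos (y + t * b) * b).
    exact: (@is_derive1_comp R (@sin R) (fun t => (y + t * b))).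
  apply: is_derive_eq; rewrite /GRing.scale /= /dg /fdre /fdim; ring.
have gc : continuous g.
  by move=> t; apply: differentiable_continuous; apply/derivable1_diffP; exact: ex_derive.
have [c] := @MVT R g dg 0 1 ltr01 (fun t _ => dgP t) (continuous_subspaceT gc).
rewrite in_itv /= => c01; rewrite subr0 mulr1 => e; exists c => //.
by rewrite -/(dg c) -e /g !mul1r !mul0r !addr0; ring.
Qed.
End RealForm.

(** * The plane: topology, conjugation, connected sets *)

Section Plane.
Variable R : realType.
Local Notation C := (R[i]^o).
Local Notation Re := (@complex.Re R).
Local Notation Im := (@complex.Im R).
Local Notation f := (fbaker R).
Implicit Types z w a b : C.

(** The modulus with values in R, whereas the norm of the plane has values in
R[i]. *)
Definition nrm z : R := Num.sqrt (Re z ^+ 2 + Im z ^+ 2).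

Lemma normE z : `|z| = (nrm z)%:C.
Proof. exact: normc_def. Qed.

Lemma nrm_sqr z : nrm z ^+ 2 = Re z ^+ 2 + Im z ^+ 2.
Proof. by rewrite sqr_sqrtr// addr_ge0 ?sqr_ge0. Qed.

Lemma nrm_ge0 z : 0 <= nrm z.
Proof. exact: sqrtr_ge0. Qed.

Lemma ReD z w : Re (z + w) = Re z + Re w. Proof. by case: z w => ? ? [? ?]. Qed.
Lemma ImD z w : Im (z + w) = Im z + Im w. Proof. by case: z w => ? ? [? ?]. Qed.
Lemma ReN z : Re (- z) = - Re z. Proof. by case: z. Qed.
Lemma ImN z : Im (- z) = - Im z. Proof. by case: z. Qed.
Lemma ReB z w : Re (z - w) = Re z - Re w. Proof. by rewrite ReD ReN. Qed.
Lemma ImB z w : Im (z - w) = Im z - Im w. Proof. by rewrite ImD ImN. Qed.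

Lemma complexP z w : Re z = Re w -> Im z = Im w -> z = w.
Proof. by case: z w => ? ? [? ?] /= -> ->. Qed.

Lemma nrmD z w : nrm (z + w) <= nrm z + nrm w.
Proof.
by have := ler_normD z w; rewrite !normE -rmorphD lecR.
Qed.

Lemma nrmN z : nrm (- z) = nrm z.
Proof. by rewrite /nrm ReN ImN !sqrrN. Qed.

Lemma nrmB z w : nrm (z - w) = nrm (w - z).
Proof. by rewrite -nrmN opprB. Qed.

Lemma nrm_dist z w a : nrm (z - w) <= nrm (z - a) + nrm (a - w).
Proof. by apply: le_trans (nrmD _ _); rewrite addrA subrK. Qed.

Lemma Re_le_nrm z : `|Re z| <= nrm z.
Proof. by rewrite -sqrtr_sqr ler_wsqrtr// lerDl sqr_ge0. Qed.

Lemma Im_le_nrm z : `|Im z| <= nrm z.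
Proof. by rewrite -sqrtr_sqr ler_wsqrtr// lerDr sqr_ge0. Qed.

Lemma nrm_le_sum z : nrm z <= `|Re z| + `|Im z|.
Proof.
rewrite -(ler_pXn2r (n:=2)) ?nnegrE ?nrm_ge0 ?addr_ge0//.
rewrite nrm_sqr sqrrD !real_normK ?num_real//.
by have := normr_ge0 (Re z); have := normr_ge0 (Im z); nra.
Qed.

Lemma cauchy_nrm z w : Re z * Re w + Im z * Im w <= nrm z * nrm w.
Proof.
have [/le_trans->//|h] := leP (Re z * Re w + Im z * Im w) 0; first by rewrite mulr_ge0 ?nrm_ge0.
rewrite -(ler_pXn2r (n:=2)) ?nnegrE ?mulr_ge0 ?nrm_ge0 ?(ltW h)//.
by rewrite exprMn !nrm_sqr; have := sqr_ge0 (Re z * Im w - Im z * Re w); nra.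
Qed.

Lemma nrm_eq0 z : nrm z = 0 -> z = 0.
Proof.
move=> h; have h1 := Re_le_nrm z; have h2 := Im_le_nrm z.
by rewrite h !normr_le0 in h1 h2; apply: complexP; [exact/eqP|exact/eqP].
Qed.

Lemma nbhs_nrmP z (V : set C) :
  nbhs z V <-> exists2 e : R, 0 < e & forall w, nrm (w - z) < e -> V w.
Proof.
rewrite nbhs_ballP; split=> [[e /= e0 h]|[e e0 h]].
  have er : e = (complex.Re e)%:C by rewrite RRe_real// gtr0_real.
  exists (complex.Re e); first by rewrite -ltcR -er.
  move=> w wz; apply: h; rewrite -ball_normE /ball_ /= er normE ltcR.
  by rewrite nrmB.
exists (e%:C); first by rewrite /= ltcR.
by move=> w; rewrite -ball_normE /ball_ /= normE ltcR nrmB => /h.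
Qed.

Lemma nbhs_ball_nrm z (e : R) : 0 < e -> nbhs z [set w | nrm (w - z) < e].
Proof. by move=> e0; apply/nbhs_nrmP; exists e. Qed.

Lemma continuous_Re : continuous (Re : C -> R).
Proof.
move=> z; apply/(@cvgrPdist_lt _ _ _ _ (nbhs_filter z)) => e e0.
apply: filterS (nbhs_ball_nrm z e0) => w /= wz.
by rewrite -ReB; apply: le_lt_trans (Re_le_nrm _) _; rewrite nrmB.
Qed.

Lemma continuous_Im : continuous (Im : C -> R).
Proof.
move=> z; apply/(@cvgrPdist_lt _ _ _ _ (nbhs_filter z)) => e e0.
apply: filterS (nbhs_ball_nrm z e0) => w /= wz.
by rewrite -ImB; apply: le_lt_trans (Im_le_nrm _) _; rewrite nrmB.
Qed.

Lemma cvg_nrmP (T : Type) (F : set_system T) (h : T -> C) z : Filter F ->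
  (h @ F --> z) <-> (forall e : R, 0 < e -> \forall t \near F, nrm (h t - z) < e).
Proof.
move=> FF; split=> [hz e e0|hF V /nbhs_nrmP[e e0 hV]].
  exact: (hz _ (nbhs_ball_nrm z e0)).
by rewrite nbhs_filterE; apply: filterS (hF e e0) => t /hV.
Qed.

Lemma cvg_ReIm (T : Type) (F : set_system T) (h : T -> C) z : Filter F ->
  Re (h t) @[t --> F] --> Re z -> Im (h t) @[t --> F] --> Im z -> h @ F --> z.
Proof.
move=> FF /cvgrPdist_lt h1 /cvgrPdist_lt h2; apply/cvg_nrmP => e e0.
have e2 : 0 < e / 2 by rewrite divr_gt0.
near=> t; apply: le_lt_trans (nrm_le_sum _) _; rewrite ReB ImB.
rewrite (splitr e) ltrD// distrC; near: t; [exact: h1|exact: h2].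
Unshelve. all: by end_near. Qed.

Lemma Re_f z : Re (f z) = fre (Re z) (Im z).
Proof. by rewrite /fbaker ReD /cexp /= ReN ImN cosN. Qed.

Lemma Im_f z : Im (f z) = fim (Re z) (Im z).
Proof. by rewrite /fbaker ImD /cexp /= ReN ImN sinN mulrN. Qed.

Lemma cvg_expN_Re z : expR (- Re w) @[w --> z] --> expR (- Re z).
Proof.
have hR : Re w @[w --> z] --> Re z := @continuous_Re z.
apply: (@cvg_comp _ _ _ (fun w : C => - Re w) (@expR R) _ _ _ (cvgN hR)).
exact: continuous_expR.
Qed.

Lemma cvg_cos_Im z : cos (Im w) @[w --> z] --> cos (Im z).
Proof.
have hI : Im w @[w --> z] --> Im z := @continuous_Im z.
by apply: (@cvg_comp _ _ _ Im (@cos R) _ _ _ hI); exact: continuous_cos.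
Qed.

Lemma cvg_sin_Im z : sin (Im w) @[w --> z] --> sin (Im z).
Proof.
have hI : Im w @[w --> z] --> Im z := @continuous_Im z.
by apply: (@cvg_comp _ _ _ Im (@sin R) _ _ _ hI); exact: continuous_sin.
Qed.

Lemma cvg_f z : f w @[w --> z] --> f z.
Proof.
have hR : Re w @[w --> z] --> Re z := @continuous_Re z.
have hI : Im w @[w --> z] --> Im z := @continuous_Im z.
have hE := @cvg_expN_Re z; have hC := @cvg_cos_Im z; have hS := @cvg_sin_Im z.
have hRe : Re (f w) @[w --> z] --> Re (f z).
  rewrite Re_f; under eq_fun do rewrite Re_f.
  exact: (cvgD hR (cvgM hE hC)).
have hIm : Im (f w) @[w --> z] --> Im (f z).
  rewrite Im_f; under eq_fun do rewrite Im_f.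
  exact: (cvgB hI (cvgM hE hS)).
exact: cvg_ReIm hRe hIm.
Qed.

Lemma continuous_f : continuous f.
Proof. move=> z; exact: cvg_f. Qed.

Lemma continuous_iter n : continuous (iter n f).
Proof.
elim: n => [|n IH] z /=; first exact: cvg_id.
apply: (@continuous_comp _ _ _ (iter n f) f); [exact: IH|exact: continuous_f].
Qed.

Definition cj z : C := (Re z) +i* (- Im z).

Lemma cjK : involutive cj.
Proof. by case=> x y; rewrite /cj /= opprK. Qed.

Lemma cj_f z : f (cj z) = cj (f z).
Proof.
apply: complexP; rewrite ?Re_f ?Im_f /= ?Re_f ?Im_f /= /fre /fim ?cosN //.
by rewrite sinN; ring.
Qed.

Lemma cj_iter n z : iter n f (cj z) = cj (iter n f z).
Proof. by elim: n => //= n ->; exact: cj_f. Qed.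

Lemma nrm_cj z : nrm (cj z) = nrm z.
Proof. by rewrite /nrm /= sqrrN. Qed.

Lemma cjB z w : cj z - cj w = cj (z - w).
Proof. by apply: complexP; rewrite ?ReB ?ImB /= ?ReB ?ImB //; ring. Qed.

Lemma continuous_cj : continuous cj.
Proof.
move=> z; apply/(@cvg_nrmP _ _ _ _ (nbhs_filter z)) => e e0.
apply: filterS (nbhs_ball_nrm z e0) => w wz.
by rewrite cjB nrm_cj.
Qed.

Lemma ball_connected z (e : R) : 0 < e -> connected [set w : C | nrm (w - z) < e].
Proof.
move=> e0.
pose seg w (t : R) : C := (Re z + t * (Re w - Re z)) +i* (Im z + t * (Im w - Im z)).
have segc w : continuous (seg w).
  move=> t; apply: cvg_ReIm => /=; apply: cvgD; try exact: cvg_cst; apply: cvgMl; exact: cvg_id.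
have -> : [set w : C | nrm (w - z) < e] =
    \bigcup_(w in [set w : C | nrm (w - z) < e]) (seg w @` `[0, 1]).
  apply/seteqP; split=> [w wz|w [v vz [t]]].
    exists w => //; exists 1; first by rewrite /= in_itv /= ler01 lexx.
    by apply: complexP; rewrite /=; ring.
  rewrite /= in_itv /= => /andP[t0 t1] <- /=.
  apply: le_lt_trans vz; rewrite /nrm ler_wsqrtr// ?ReB ?ImB /=.
  have -> : Re z + t * (Re v - Re z) - Re z = t * (Re v - Re z) by ring.
  have -> : Im z + t * (Im v - Im z) - Im z = t * (Im v - Im z) by ring.
  rewrite !exprMn -mulrDr ler_piMl ?addr_ge0 ?sqr_ge0// expr_le1//.
apply: bigcup_connected.
  exists z => w _; exists 0; first by rewrite /= in_itv /= ler01 lexx.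
  by apply: complexP; rewrite /=; ring.
move=> w wz; apply: connected_continuous_connected; first exact: segment_connected.
exact: continuous_subspaceT.
Qed.

Lemma real_line_connected : connected [set z : C | Im z = 0].
Proof.
have -> : [set z : C | Im z = 0] = (fun x : R => x +i* 0 : C) @` setT.
  apply/seteqP; split=> [z z0|z [x _ <-]//]; exists (Re z) => //; exact: complexP.
apply: connected_continuous_connected; first by apply/connected_intervalP.
apply: continuous_subspaceT => x; apply: cvg_ReIm => /=; [exact: cvg_id|exact: cvg_cst].
Qed.

End Plane.

(** * The petal and its basin *)

Lemma nat_subseq (P : nat -> Prop) : (forall K, exists2 k, (K <= k)%N & P k) ->
  exists2 phi : nat -> nat, {homo phi : m n / (m < n)%N} & forall k, P (phi k).
Proof.
move=> h.
have /choice[c hc] : forall K, exists k, (K <= k)%N /\ P k.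
  by move=> K; have [k] := h K; exists k.
pose phi := fix F n := if n is n'.+1 then c (F n').+1 else c 0%N.
exists phi; last by case=> [|n]; [exact: (hc 0%N).2|exact: (hc _).2].
apply: (@homo_ltn _ phi (fun a b => is_true (a < b)%N)) => [y x z|n]; first exact: ltn_trans.
exact: (hc (phi n).+1).1.
Qed.

Section Petal.
Variable R : realType.
Local Notation C := (R[i]^o).
Local Notation Re := (@complex.Re R).
Local Notation Im := (@complex.Im R).
Local Notation f := (fbaker R).
Local Notation F := (fatou_set (fbaker R)).
Implicit Types z w a b : C.

(** Since 0 <= sin y <= y, the point y - r sin y lies between - y and y when 0
<= y <= pi and r <= 2. *)
Lemma kepler_norm (r y : R) : 0 <= r <= 2 -> `|y| <= pi -> `|y - r * sin y| <= `|y|.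
Proof.
move=> /andP[r0 r2]; wlog y0 : y / 0 <= y => [hw|] ypi.
  have [/hw|y0] := leP 0 y; first exact.
  have := hw (- y); rewrite sinN mulrN opprK normrN oppr_ge0 (ltW y0) => /(_ isT ypi).
  by rewrite (distrC y) (addrC (- y)).
rewrite (ger0_norm y0) in ypi *.
have s0 : 0 <= sin y by rewrite sin_ge0_pi// y0.
have s1 := sin_le_id y0.
by rewrite ler_norml; apply/andP; split; nra.
Qed.

(** With w = exp(- z), this is, in the open strip, the disc |w - 1| < 1, that
is, |f'(z)| < 1. *)
Definition petal : set C := [set z | `|Im z| < pi /\ expR (- Re z) < 2 * cos (Im z)].
(** The component of this set that contains the real axis is the Baker domain of
the strip. *)
Definition basin : set C := [set z | exists n, petal (iter n f z)].

Lemma petal_step z : petal z ->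
  [/\ petal (f z), cos (Im z) <= cos (Im (f z)) & Re (f z) = Re z + expR (- Re z) * cos (Im z)].
Proof.
case=> ypi hr; have r0 := expR_gt0 (- Re z).
have c1 := cos_le1 (Im z).
have c0 : 0 <= cos (Im z) by lra.
have hy : `|Im (f z)| <= `|Im z|.
  by rewrite Im_f; apply: kepler_norm; [apply/andP; split; lra|exact: ltW].
have hc : cos (Im z) <= cos (Im (f z)) by apply: ler_cos_norm => //; exact: ltW.
have hre : Re (f z) = Re z + expR (- Re z) * cos (Im z) by rewrite Re_f.
split=> //; split; first exact: le_lt_trans ypi.
apply: lt_le_trans (_ : 2 * cos (Im z) <= _); last by lra.
apply: le_lt_trans hr; rewrite ler_expR hre lerN2 lerDl.
by rewrite mulr_ge0 ?expR_ge0.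
Qed.

(** With e^x as unknown, x -> x + e^(- x) cos y increases it by at least cos y,
which is bounded below along the orbit by its initial value, itself at least
e^(- x) / 2. The linear growth of e^x follows. *)
Lemma petal_iter z k : petal z ->
  [/\ petal (iter k f z), cos (Im z) <= cos (Im (iter k f z)) &
   k%:R * (expR (- Re z) / 2) <= expR (Re (iter k f z))].
Proof.
move=> hz; elim: k => [|k [IH1 IH2 IH3]]; first by split=> //=; rewrite mul0r expR_ge0.
have [h1 h2 h3] := petal_step IH1; split=> //=; first exact: le_trans h2.
rewrite h3 expRD; set c := cos _.
have ew := expR_ge1Dx (expR (- Re (iter k f z)) * c).
have e0 := expR_gt0 (Re (iter k f z)).
apply: le_trans (_ : expR (Re (iter k f z)) + c <= _); last first.
  apply: le_trans (_ : expR (Re (iter k f z)) * (1 + expR (- Re (iter k f z)) * c) <= _).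
    by rewrite mulrDr mulr1 mulrA expRxMexpNx_1 mul1r.
  by rewrite ler_pM2l.
rewrite mulrSr mulrDl mul1r lerD//.
case: hz => _ hz; have : cos (Im z) <= c by [].
lra.
Qed.

Lemma basin_f z : basin (f z) -> basin z.
Proof. by case=> n h; exists n.+1; rewrite iterSr. Qed.

Lemma basin_fw z : basin z -> basin (f z).
Proof.
case=> n h; exists n; rewrite -iterSr iterS.
by have [] := petal_step h.
Qed.

Lemma basin_iter n z : basin (iter n f z) <-> basin z.
Proof.
split; elim: n => //= n IH h; first by apply: IH; exact: basin_f.
by apply: basin_fw; exact: IH.
Qed.

Lemma real_basin z : Im z = 0 -> basin z.
Proof.
move=> z0.
have pos w : Im w = 0 -> 0 <= Re w -> petal w.
  move=> w0 w1; split; rewrite w0 ?normr0 ?pi_gt0// cos0.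
  by apply: le_lt_trans (_ : 1 < _); rewrite ?expR_le1; lra.
have [h|h] := leP 0 (Re z); first by exists 0%N; exact: pos.
exists 1%N; apply: pos => /=; rewrite ?Re_f ?Im_f /fim /fre z0 ?sin0 ?cos0; first by ring.
by have := expR_ge1Dx (- Re z); lra.
Qed.

Lemma petal_open : open petal.
Proof.
rewrite (_ : petal = (fun z => `|Im z|) @^-1` [set x | x < pi] `&`
   (fun z => 2 * cos (Im z) - expR (- Re z)) @^-1` [set x | 0 < x]); last first.
  by apply/seteqP; split=> z /=; case=> h1 h2; split=> //; rewrite ?subr_gt0 // -subr_gt0.
have cI := @continuous_Im R.
apply: openI; apply: open_comp; try exact: open_lt; try exact: open_gt.
  by move=> z _; have hI : Im w @[w --> z] --> Im z := cI z; exact: (cvg_norm hI).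
move=> z _; exact: (cvgB (cvgM (cvg_cst _) (@cvg_cos_Im R z)) (@cvg_expN_Re R z)).
Qed.

Lemma basin_open : open basin.
Proof.
rewrite (_ : basin = \bigcup_n (iter n f @^-1` petal)); last first.
  by apply/seteqP; split=> z [n]; exists n.
apply: bigcup_open => n _; apply: open_comp; last exact: petal_open.
by move=> z _; exact: continuous_iter.
Qed.

(** Near z the orbits enter the petal at a common time, at a point with bounded
real part, and from then on the bound of [petal_iter] is uniform. *)
Lemma basin_dvg_Re z : basin z -> exists2 V : set C, nbhs z V &
  forall M : R, exists N, forall n, (N <= n)%N -> forall w, V w -> M <= Re (iter n f w).
Proof.
case=> m hm; pose X := Re (iter m f z) + 1.
exists [set w | petal (iter m f w) /\ Re (iter m f w) < X].
  have cm : iter m f w @[w --> z] --> iter m f z := @continuous_iter R m z.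
  have hp : nbhs z (iter m f @^-1` petal).
    by apply: cm; apply: open_nbhs_nbhs; split => //; exact: petal_open.
  have hr : nbhs z [set w | Re (iter m f w) < X].
    apply: (cm [set v | Re v < X]).
    apply: (@continuous_Re R (iter m f z) [set x | x < X]).
    by apply: lt_nbhsl; rewrite /X ltrDl.
  exact: filterI.
move=> M; pose c := expR (- X) / 2.
have c0 : 0 < c by rewrite divr_gt0 ?expR_gt0.
pose K := (Num.truncn (expR M / c)).+1.
have hK : expR M / c < K%:R by rewrite truncnS_gt.
exists (K + m)%N => n hn w [hw hX].
have -> : n = ((n - m) + m)%N by rewrite subnK// (leq_trans _ hn)// leq_addl.
rewrite iterD; have [_ _] := petal_iter (n - m) hw.
move=> hg; rewrite -ler_expR; apply: le_trans hg.
have h1 : expR M <= K%:R * c by rewrite -ler_pdivrMr// ltW.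
have h2 : K%:R <= (n - m)%:R :> R by rewrite ler_nat leq_subRL ?(leq_trans _ hn) ?leq_addl// addnC.
have h3 : c <= expR (- Re (iter m f w)) / 2.
  by rewrite /c ler_pM2r ?invr_gt0// ler_expR lerN2 ltW.
by apply: le_trans h1 _; apply: ler_pM => //; exact: ltW.
Qed.

Lemma basin_Re z : basin z -> forall M : R, exists N, forall n, (N <= n)%N -> M <= Re (iter n f z).
Proof.
move=> /basin_dvg_Re[V nV hV] M; have [N hN] := hV M.
by exists N => n /hN; apply; exact: nbhs_singleton.
Qed.

(** A sequence of iterates either takes one of them infinitely often, which
gives a constant subsequence, or diverges with its indices. *)
Lemma basin_sub_fatou : basin `<=` F.
Proof.
move=> z hz; exists basin; split=> //; first exact: basin_open.
move=> u hu.
have /choice[nn hnn] : forall k, exists n, u k = iter n f.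
  by move=> k; have [n _ <-] := hu k; exists n.
have [[m hm]|hN] := pselect (exists m, forall K, exists2 k, (K <= k)%N & nn k = m).
  have [phi hphi hP] := nat_subseq hm.
  exists phi => //; left; exists (iter m f) => w _; exists setT; first exact: filterT.
  have -> : u \o phi = fun=> iter m f by apply/funext => k /=; rewrite hnn hP.
  by move=> Q hQ; exists 0%N => // k _; exact: nbhs_singleton hQ.
exists id => //; right => w hw; have [V nV hV] := basin_dvg_Re hw.
exists V => // M; have [N hM] := hV M.
have {hN} hN : forall N, exists K, forall k, (K <= k)%N -> (N <= nn k)%N.
  elim=> [|N' [K hK]]; first by exists 0%N.
  have [K' hK'] : exists K, forall k, (K <= k)%N -> nn k <> N'.
    apply: contrapT => /forallNP h; apply: hN; exists N' => K'.
    have /existsNP[k /not_implyP[kK /contrapT kN]] := h K'.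
    by exists k.
  exists (maxn K K') => k; rewrite geq_max => /andP[k1 k2].
  rewrite ltn_neqAle hK// andbT; apply/eqP => e; exact: (hK' k).
have [K hK] := hN N.
exists K => // k /= kK v Vv; rewrite hnn normE lecR.
apply: le_trans (hM _ (hK k kK) v Vv) _.
by apply: le_trans (Re_le_nrm _); exact: ler_norm.
Qed.

Lemma fatou_nbhs z : F z -> nbhs z F.
Proof.
case=> W [oW Wz nW]; have : nbhs z W by exact: open_nbhs_nbhs.
by apply: filterS => w Ww; exists W.
Qed.

(** Stated for connected sets that meet the component, which is the form in
which paths, balls and the real axis are shown to lie in it. *)
Lemma component_absorb (A : set C) z0 :
  connected A -> A `<=` F -> A `&` connected_component F z0 !=set0 ->
  A `<=` connected_component F z0.
Proof.
move=> cA AF [w [Aw Uw]]; rewrite (same_connected_component Uw).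
exact: connected_component_max.
Qed.

Lemma component_nbhs z0 z : connected_component F z0 z -> nbhs z (connected_component F z0).
Proof.
move=> Uz; have /fatou_nbhs/nbhs_nrmP[e e0 he] := connected_component_sub Uz.
apply/nbhs_nrmP; exists e => //; apply: component_absorb => //; first exact: ball_connected.
exists z; split=> //=; rewrite subrr /nrm /= expr0n /= addr0 sqrtr0 //.
Qed.

End Petal.

(** * The Baker domain of the strip *)

Section Identify.
Variable R : realType.
Local Notation C := (R[i]^o).
Local Notation Re := (@complex.Re R).
Local Notation Im := (@complex.Im R).
Local Notation f := (fbaker R).
Local Notation F := (fatou_set (fbaker R)).
Local Notation basin := (@basin R).
Local Notation cj := (@cj R).
Implicit Types z w a b : C.

Lemma uniform_cvg_nrmP (V : set C) (u : nat -> C -> C) (g : C -> C) :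
  {uniform V, u @ \oo --> g} <->
  forall e : R, 0 < e -> \forall n \near \oo, forall w, V w -> nrm (g w - u n w) < e.
Proof.
split=> [h e e0|h P /uniform_nbhs[E [entE hP]]].
  apply: (h [set h | forall w, V w -> nrm (g w - h w) < e]).
  apply/uniform_nbhs; exists [set xy : C * C | nrm (xy.1 - xy.2) < e]; split=> //.
  rewrite -entourage_ballE; exists (e%:C); first by rewrite /= ltcR.
  by move=> [x y] /=; rewrite -ball_normE /ball_ /= normE ltcR.
move: entE; rewrite -entourage_ballE => -[e /= e0 hE].
have er : e = (complex.Re e)%:C by rewrite RRe_real// gtr0_real.
have er0 : 0 < complex.Re e by rewrite -ltcR -er.
have [N _ hN] := h _ er0; exists N => // n Nn; apply: hP => w Vw; apply: (hE (_, _)).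
by rewrite /= -ball_normE /ball_ /= normE er ltcR; exact: hN.
Qed.

Lemma nbhs_cj (V : set C) z : nbhs (cj z) V -> nbhs z (cj @^-1` V).
Proof. exact: (@continuous_cj R z). Qed.

Lemma fatou_cj z : F z -> F (cj z).
Proof.
case=> W [oW Wz nW]; exists (cj @^-1` W); split.
- by apply: open_comp => // w _; exact: continuous_cj.
- by rewrite /= cjK.
move=> u hu; have [phi hphi [[g hg]|hd]] := nW u hu; exists phi => //; [left|right].
  exists (cj \o g \o cj) => w Ww; have [V nV hV] := hg _ Ww.
  exists (cj @^-1` V); first exact: nbhs_cj.
  apply/uniform_cvg_nrmP => e e0.
  have [N _ hN] := (uniform_cvg_nrmP _ _ _).1 hV e e0.
  exists N => // n Nn v Vv; have := hN n Nn _ Vv.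
  by have [m _ /= <-] := hu (phi n); rewrite cj_iter -nrm_cj -cjB cjK.
move=> w Ww; have [V nV hV] := hd _ Ww.
exists (cj @^-1` V); first exact: nbhs_cj.
move=> M; have [N _ hN] := hV M; exists N => // n Nn v Vv; have := hN n Nn _ Vv.
by have [m _ /= <-] := hu (phi n); rewrite cj_iter !normE nrm_cj.
Qed.

Lemma component_cj_sub z : cj @` connected_component F z `<=` connected_component F (cj z).
Proof.
have [Fz|nFz] := pselect (F z); last first.
  by rewrite connected_component_out// image_set0; exact: sub0set.
apply: component_absorb.
- apply: connected_continuous_connected; first exact: component_connected.
  apply: continuous_subspaceT => w; exact: continuous_cj.
- by move=> _ [w /connected_component_sub hw <-]; exact: fatou_cj.
- exists (cj z); split; first by exists z => //; exact: connected_component_refl.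
  by apply: connected_component_refl; exact: fatou_cj.
Qed.

Lemma component_cj z : cj @` connected_component F z = connected_component F (cj z).
Proof.
apply/seteqP; split; first exact: component_cj_sub.
move=> w hw; exists (cj w); last exact: cjK.
have : (cj @` connected_component F (cj z)) (cj w) by exists w.
by move/component_cj_sub; rewrite cjK.
Qed.

Lemma baker_cj (U : set C) : baker_domain f U -> baker_domain f (cj @` U).
Proof.
case=> -[[z Fz Uz] [p p0 hp]] hd; split; first split.
- exists (cj z); first exact: fatou_cj.
  by rewrite Uz component_cj.
- exists p => // _ [_ [w Uw <-] <-]; rewrite cj_iter; exists (iter p f w) => //.
  by apply: hp; exists w.
move=> _ [w Uw <-]; have [V nV hV] := hd _ Uw.
exists (cj @^-1` V); first by apply: nbhs_cj; rewrite cjK.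
move=> M; have [N _ hN] := hV M; exists N => // n Nn v Vv; have := hN n Nn _ Vv.
by rewrite cj_iter !normE nrm_cj.
Qed.

(** Far to the right a step has length less than 1, so the orbit cannot leave
that side of the strip while remaining large, and |y| decreases. If cos y <= 0
held forever, x would decrease, contrary to divergence; once cos y > 0, cos y
increases and e^(- x) < 2 cos y holds eventually. *)
Lemma far_right_basin z : `|Im z| <= pi -> 3 <= Re z ->
  (forall n, pi + 3 <= nrm (iter n f z)) ->
  (forall M : R, exists N, forall n, (N <= n)%N -> M <= nrm (iter n f z)) -> basin z.
Proof.
move=> iz rz far dvg.
have inv n : [/\ `|Im (iter n f z)| <= pi, 3 <= Re (iter n f z) &
    `|Im (iter n.+1 f z)| <= `|Im (iter n f z)|].
  have step w : `|Im w| <= pi -> 3 <= Re w -> `|Im (f w)| <= `|Im w|.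
    move=> iw rw; rewrite Im_f; apply: kepler_norm => //; rewrite expR_ge0 /=.
    by apply: le_trans (_ : 1 <= _); rewrite ?expR_le1; lra.
  elim: n => [|n [IH1 IH2 IH3]]; first by split=> //; exact: step.
  have i1 := le_trans IH3 IH1.
  suff r1 : 3 <= Re (iter n.+1 f z) by split=> //; exact: step.
  have r2 : 2 <= Re (iter n.+1 f z).
    rewrite iterS Re_f /fre; set w := iter n f z.
    have e1 : expR (- Re w) <= 1 by rewrite expR_le1; rewrite -/w in IH2; lra.
    have e0 := expR_gt0 (- Re w); have c1 := cos_geN1 (Im w).
    rewrite -/w in IH2; nra.
  have := far n.+1; have := nrm_le_sum (iter n.+1 f z).
  rewrite (ger0_norm (_ : 0 <= Re _)); lra.
have inf M : exists N, forall n, (N <= n)%N -> M <= Re (iter n f z).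
  have [N hN] := dvg (M + pi); exists N => n /hN h.
  have [i1 r1 _] := inv n; have := nrm_le_sum (iter n f z).
  by rewrite (ger0_norm (_ : 0 <= Re _)); lra.
have [n hn] : exists n, 0 < cos (Im (iter n f z)).
  apply: contrapT => /forallNP hc.
  have dec n : Re (iter n f z) <= Re z.
    elim: n => // n IH; apply: le_trans IH; rewrite iterS Re_f /fre.
    have /negP := hc n; rewrite -leNgt => h.
    by rewrite gerDl mulr_ge0_le0// expR_ge0.
  have [N /(_ N (leqnn N))] := inf (Re z + 1).
  by have := dec N; lra.
have mono k : cos (Im (iter n f z)) <= cos (Im (iter (k + n) f z)).
  elim: k => // k IH; apply: (le_trans IH); rewrite addSn.
  by have [h1 _ h2] := inv (k + n)%N; exact: ler_cos_norm.
set c := cos _ in hn mono.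
have [N hN] := inf (- ln c).
exists (N + n)%N; split.
  have [h1 h2 h3] := inv (N + n)%N; rewrite lt_neqAle h1 andbT.
  apply/eqP => e; have := mono N.
  by rewrite -(cos_norm (Im _)) e cospi; lra.
have := hN (N + n)%N (leq_addr _ _); rewrite -lerN2 opprK -ler_expR lnK ?posrE// => h.
by have := mono N; lra.
Qed.

Section Domain.
Variable U : set C.
Hypothesis hU : unique (fun V : set C => baker_domain f V /\ V `<=` strip R) U.

(** The conjugate of U is a Baker domain in the strip, so it is U. *)
Lemma domain_cj z : U z -> U (cj z).
Proof.
move=> Uz; have [[bU sU] uU] := hU.
have : U = cj @` U.
  apply: uU; split; first exact: baker_cj.
  by move=> _ [w Uw <-]; have := sU _ Uw; rewrite /strip /= normrN.
by move=> ->; exists z.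
Qed.

Lemma domain_component : exists2 z0, F z0 & U = connected_component F z0.
Proof. by have [[[[]]]] := hU. Qed.

Lemma domain_connected : connected U.
Proof. by have [z0 _ ->] := domain_component; exact: component_connected. Qed.

Lemma domain_nbhs z : U z -> nbhs z U.
Proof. by have [z0 _ ->] := domain_component; exact: component_nbhs. Qed.

Lemma domain_absorb (A : set C) :
  connected A -> A `<=` basin -> A `&` U !=set0 -> A `<=` U.
Proof.
have [z0 _ ->] := domain_component => cA AB; apply: component_absorb => //.
by move=> w /AB; exact: basin_sub_fatou.
Qed.

Lemma domain_strip : U `<=` strip R.
Proof. by have [[]] := hU. Qed.

(** By symmetry Im takes opposite values on the connected set U, so it vanishes
somewhere on U. *)
Lemma real_sub_domain z : Im z = 0 -> U z.
Proof.
move=> z0; apply: (domain_absorb (@real_line_connected R)) => //.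
  by move=> w; exact: real_basin.
apply: contrapT => hn.
have nz w : U w -> Im w != 0 by move=> Uw; apply/eqP => w0; apply: hn; exists w.
have [w0 Fw0 Uw0] := domain_component.
have Uw : U w0 by rewrite Uw0; exact: connected_component_refl.
have cIm : connected (Im @` U).
  apply: connected_continuous_connected; first exact: domain_connected.
  by apply: continuous_subspaceT => w; exact: continuous_Im.
have /connected_intervalP hI := cIm.
suff : (Im @` U) 0 by case=> v Uv v0; have := nz _ Uv; rewrite v0 eqxx.
have h1 : (Im @` U) (Im w0) by exists w0.
have h2 : (Im @` U) (- Im w0) by exists (cj w0) => //; exact: domain_cj.
have [h|h] := leP 0 (Im w0); [apply: (hI _ _ h2 h1)|apply: (hI _ _ h1 h2)]; lra.
Qed.

(** The basin is open, so it suffices that it is closed in U. On a small ball of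
U the real parts of the iterates at large multiples of the period have modulus
at least 3, hence constant sign on the ball; at a point outside the basin they
are negative by [far_right_basin], whereas at a point of the basin they are
eventually positive. *)
Lemma domain_sub_basin : U `<=` basin.
Proof.
have [[[[_ [p p0 hp]] hd] sU] _] := hU.
have itp m z : U z -> U (iter (m * p) f z).
  move=> Uz; elim: m => // m IH; rewrite mulSn iterD; apply: hp; by exists (iter (m * p) f z).
have loc z : U z -> ~ basin z -> exists2 V : set C, nbhs z V & V `<=` ~` basin.
  move=> Uz nbz; have [V nV hV] := hd z Uz.
  have /nbhs_nrmP[e e0 he] : nbhs z (V `&` U) by apply: filterI => //; exact: domain_nbhs.
  pose B := [set w : C | nrm (w - z) < e].
  have [N _ hN] := hV (pi + 3).
  have Nm m : (N <= m)%N -> (N <= m * p)%N by move=> h; rewrite (leq_trans h)// leq_pmulr.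
  have far m w k : (N <= m)%N -> B w -> pi + 3 <= nrm (iter k f (iter (m * p) f w)).
    move=> /Nm h /he[Vw _]; rewrite -iterD -lecR -normE; apply: hN => //=.
    exact: leq_trans (leq_addl _ _).
  have Re3 m w : (N <= m)%N -> B w -> 3 <= `|Re (iter (m * p) f w)|.
    move=> h Bw; have := far m w 0%N h Bw; have := nrm_le_sum (iter (m * p) f w).
    by have /sU := itp m w (he _ Bw).2; rewrite /strip /=; lra.
  have right m w : (N <= m)%N -> B w -> 0 <= Re (iter (m * p) f w) -> basin w.
    move=> h Bw rw; apply/(basin_iter (m * p)); apply: far_right_basin.
    - by have /sU := itp m w (he _ Bw).2.
    - by have := Re3 m w h Bw; rewrite ger0_norm.
    - by move=> k; exact: far.
    - move=> M; have [K _ hK] := hV M; exists K => k Kk.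
      rewrite -iterD -lecR -normE; apply: hK; last exact: (he _ Bw).1.
      by rewrite /= (leq_trans Kk)// leq_addr.
  exists B; first exact: nbhs_ball_nrm.
  move=> w Bw bw.
  have Bz : B z by rewrite /B /= subrr /nrm /= expr0n /= addr0 sqrtr0.
  have [K hK] := basin_Re bw 0.
  pose m := maxn N K.
  have Nmx : (N <= m)%N by rewrite leq_maxl.
  have neg : Re (iter (m * p) f z) < 0 by rewrite ltNge; apply/negP => /(right m z Nmx Bz).
  have pos : 0 <= Re (iter (m * p) f w).
    by apply: hK; rewrite (leq_trans (leq_maxr N K))// leq_pmulr.
  have /connected_intervalP hI : connected ((Re \o iter (m * p) f) @` B).
    apply: connected_continuous_connected; first exact: ball_connected.
    apply: continuous_subspaceT => v.
    by apply: continuous_comp; [exact: continuous_iter|exact: continuous_Re].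
  have [v Bv v0] : ((Re \o iter (m * p) f) @` B) 0.
    apply: (hI (Re (iter (m * p) f z)) (Re (iter (m * p) f w))); [by exists z|by exists w|].
    by rewrite pos (ltW neg).
  have := Re3 m v Nmx Bv; rewrite /= in v0; rewrite v0 normr0; lra.
suff -> : U = U `&` basin by move=> z [].
apply/esym; apply: domain_connected.
- by exists 0; split; [exact: real_sub_domain|exact: real_basin].
- by exists basin => //; exact: basin_open.
exists (~` interior (~` basin)).
  by apply: open_closedC; exact: open_interior.
apply/seteqP; split=> z [Uz hz]; split=> //.
  by move=> /nbhs_singleton.
apply: contrapT => nbz; apply: hz => /=.
by have [V nV hV] := loc z Uz nbz; apply: filterS hV _.
Qed.

Lemma domain_f z : U z -> U (f z).
Proof.
move=> Uz; apply: (domain_absorb (A := f @` U)); last by exists z.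
- apply: connected_continuous_connected; first exact: domain_connected.
  by apply: continuous_subspaceT => w; exact: continuous_f.
- by move=> _ [w Uw <-]; apply: basin_fw; exact: domain_sub_basin.
exists (f 0); split; first by exists 0 => //; exact: real_sub_domain.
by apply: real_sub_domain; rewrite Im_f /fim /= sin0 mulr0 subr0.
Qed.

Lemma domain_iter n z : U z -> U (iter n f z).
Proof. by elim: n => //= n IH /IH; exact: domain_f. Qed.

Lemma boundary_strip v n : boundary U v -> `|Im (iter n f v)| <= pi.
Proof.
case=> cv _.
have cl : closed (strip R).
  rewrite (_ : strip R = (fun z : C => `|Im z|) @^-1` [set x | x <= pi])//.
  apply: closed_comp; last exact: closed_le.
  move=> z _; have hI : Im w @[w --> z] --> Im z := @continuous_Im R z.
  exact: (cvg_norm hI).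
apply: (cl (iter n f v)) => V /(@continuous_iter R n v) nV.
have [w [Uw Vw]] := cv _ nV.
by exists (iter n f w); split=> //; apply: domain_strip; exact: domain_iter.
Qed.

(** A ball about v inside the basin would be absorbed by U, and v would be
interior to U. *)
Lemma boundary_nbasin v : boundary U v -> ~ basin v.
Proof.
case=> cv iv bv; apply: iv.
have /nbhs_nrmP[e e0 he] : nbhs v basin by apply: open_nbhs_nbhs; split=> //; exact: basin_open.
apply/nbhs_nrmP; exists e => //; apply: domain_absorb => //; first exact: ball_connected.
have [w [Uw Bw]] := cv _ (nbhs_ball_nrm v e0).
by exists w.
Qed.

End Domain.
End Identify.

(** * Escaping boundary points are not accessible *)

Lemma near_left1 (R : realType) (P : R -> Prop) (a : R) : a < 1 ->
  (\forall t \near (1:R)^'-, P t) ->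
  exists2 t0, a < t0 < 1 & forall t, t0 <= t < 1 -> P t.
Proof.
move=> a1 /nbhs_ballP[e /= e0 he].
pose m := Num.max a (1 - e).
have m1 : m < 1 by rewrite gt_max a1 /=; lra.
have am : a <= m by rewrite le_max lexx.
have em : 1 - e <= m by rewrite le_max lexx orbT.
exists ((m + 1) / 2); first by apply/andP; split; lra.
move=> t /andP[t1 t2]; apply: he => //.
by rewrite /ball /= ger0_norm; lra.
Qed.

Section NonAccessible.
Variable R : realType.
Local Notation C := (R[i]^o).
Local Notation Re := (@complex.Re R).
Local Notation Im := (@complex.Im R).
Local Notation f := (fbaker R).
Local Notation basin := (@basin R).
Implicit Types z w a b v : C.

Lemma pi_le4 : pi <= 4 :> R.
Proof. by have := pihalf_lt2 R; lra. Qed.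

(** The imaginary part moves by e^(- x) |sin y| <= 2 pi, with e^(- x) >= 16, so
that |sin y| <= 1/2. *)
Lemma far_left_cos z :
  Re z < - 15 -> `|Im z| <= pi -> `|Im (f z)| <= pi -> 3 / 4 <= cos (Im z) ^+ 2.
Proof.
rewrite Im_f /fim => xz /ler_normlP[y1 y2] /ler_normlP[y3 y4].
have e16 : 16 <= expR (- Re z) by have := expR_ge1Dx (- Re z); lra.
have p4 := pi_le4.
set E := expR _ in e16 y3 y4; set s := sin _ in y3 y4.
have s1 : s <= 1 / 2 by nra.
have s2 : - (1 / 2) <= s by nra.
by have := cos2Dsin2 (Im z); rewrite -/s; nra.
Qed.

Lemma far_left_step z :
  Re z < - 15 -> 3 / 4 <= cos (Im z) ^+ 2 -> cos (Im z) < 0 -> Re (f z) < - 15.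
Proof.
rewrite Re_f /fre => xz c2 c0.
have e16 : 16 <= expR (- Re z) by have := expR_ge1Dx (- Re z); lra.
have c1 : cos (Im z) <= - (1 / 2) by nra.
nra.
Qed.

(** Here x + e^(- x) / 2 >= 0, because e^t >= (1 + t / 2)^2. *)
Lemma far_left_jump z :
  Re z < - 15 -> 3 / 4 <= cos (Im z) ^+ 2 -> 0 <= cos (Im z) -> 0 <= Re (f z).
Proof.
rewrite Re_f /fre => xz c2 c0.
have c1 : 1 / 2 <= cos (Im z) by nra.
have e1 := expR_ge1Dx (- Re z / 2).
have e2 : expR (- Re z) = expR (- Re z / 2) ^+ 2.
  by rewrite expr2 -expRD; congr expR; field.
have : (1 + - Re z / 2) ^+ 2 <= expR (- Re z) by rewrite e2 lerXn2r ?nnegrE ?expR_ge0//; lra.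
nra.
Qed.

Section Domain.
Variable U : set C.
Hypothesis hU : unique (fun V : set C => baker_domain f V /\ V `<=` strip R) U.

Lemma escaping_left v : boundary U v -> escaping f v ->
  exists N, forall n, (N <= n)%N -> Re (iter n f v) < - 15.
Proof.
move=> bv ev.
have inf (M : R) : exists N, forall n, (N <= n)%N -> M <= nrm (iter n f v).
  have [|N _ hN] := ev [set x | M%:C < x].
    by exists (M%:C); split => //; rewrite complex_real.
  by exists N => n /hN; rewrite /= normE ltcR => /ltW.
have [N hN] := inf (pi + 16).
exists N => n Nn.
have i1 := boundary_strip hU n bv.
have := hN n Nn; have := nrm_le_sum (iter n f v).
have [r0|r0] := leP 0 (Re (iter n f v)); last by rewrite ltr0_norm//; lra.
rewrite ger0_norm// => h1 h2; exfalso.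
apply: (boundary_nbasin hU bv); apply/(basin_iter n); apply: far_right_basin => //.
- lra.
- move=> k; rewrite -iterD; apply: le_trans (hN _ _); [lra|exact: leq_trans Nn (leq_addl _ _)].
- move=> M; have [K hK] := inf M; exists K => k Kk; rewrite -iterD; apply: hK.
  exact: leq_trans Kk (leq_addr _ _).
Qed.

(** The tail of a landing curve follows v: its points stay to the left of -15
forever, which no point of the basin does. *)
Lemma escaping_not_accessible v : boundary U v -> escaping f v -> ~ accessible U v.
Proof.
move=> bv ev [gam [cg sg lg]].
have [N hN] := escaping_left bv ev.
pose g j t := iter (j + N) f (gam t).
have gU j t : t \in `[0, 1[ -> U (g j t).
  by move=> t01; apply: domain_iter => //; apply: sg; exists t.
have gl j : g j t @[t --> 1^'-] --> iter (j + N) f v.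
  by apply: (@cvg_comp _ _ _ gam (iter (j + N) f) _ _ _ lg); exact: continuous_iter.
have gRe : \forall t \near (1:R)^'-, Re (g 0%N t) < - 15.
  have hR : Re w @[w --> iter (0 + N) f v] --> Re (iter (0 + N) f v) := @continuous_Re R _.
  have hc : Re (g 0%N t) @[t --> 1^'-] --> Re (iter (0 + N) f v).
    exact: (@cvg_comp _ _ _ (g 0%N) Re _ _ _ (gl 0%N) hR).
  by apply: (hc [set x | x < - 15]); apply: lt_nbhsl; exact: hN.
have [t0 /andP[t00 t01'] ht0] := near_left1 ltr01 gRe.
have t001 : t0 \in `[0, 1[ by rewrite in_itv /= (ltW t00).
have t01 t : t0 <= t < 1 -> t \in `[0, 1[.
  by move: t001; rewrite !in_itv /= => /andP[? ?] /andP[? ->]; rewrite andbT; lra.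
have c2 j t : t0 <= t < 1 -> Re (g j t) < - 15 -> 3 / 4 <= cos (Im (g j t)) ^+ 2.
  move=> ht hr; apply: far_left_cos => //; first by apply: (domain_strip hU); apply: gU; exact: t01.
  by have := gU j.+1 t (t01 t ht); rewrite /g addSn iterS => /(domain_strip hU).
have main j t : t0 <= t < 1 -> Re (g j t) < - 15.
  elim: j t => [//|j IH t ht].
  rewrite /g addSn iterS; apply: far_left_step; [exact: IH|exact: (c2 j t ht (IH t ht))|].
  rewrite ltNge; apply/negP => ct.
  have cvI : cos (Im (g j s)) @[s --> 1^'-] --> cos (Im (iter (j + N) f v)).
    have hI : Im w @[w --> iter (j + N) f v] --> Im (iter (j + N) f v) := @continuous_Im R _.
    have hg := @cvg_comp _ _ _ (g j) Im _ _ _ (gl j) hI.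
    apply: (@cvg_comp _ _ _ (fun s => Im (g j s)) (@cos R) _ _ _ hg).
    exact: continuous_cos.
  have hv n : (N <= n)%N -> 3 / 4 <= cos (Im (iter n f v)) ^+ 2.
    move=> Nn; apply: far_left_cos; [exact: hN|exact: (boundary_strip hU n bv)|].
    exact: (boundary_strip hU n.+1 bv).
  have negv : cos (Im (iter (j + N) f v)) < 0.
    rewrite ltNge; apply/negP => cv.
    have Nj : (N <= j + N)%N := leq_addl _ _.
    have := far_left_jump (hN _ Nj) (hv _ Nj) cv.
    have := hN (j + N).+1 (leqW Nj); rewrite iterS; lra.
  have cneg : \forall s \near (1:R)^'-, cos (Im (g j s)) < 0.
    by apply: (cvI [set x | x < 0]); exact: lt_nbhsl.
  have t1 : t < 1 by case/andP: ht.
  have [s /andP[ts s1] /(_ s)] := near_left1 t1 cneg.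
  rewrite lexx s1 => /(_ isT) cs.
  have cont : {within `[t, s], continuous (fun r => cos (Im (g j r)))}.
    have cts : {within `[t, s], continuous gam}.
      apply: continuous_subspaceW cg => r /=; rewrite !in_itv /= => /andP[r1 r2].
      by case/andP: ht => h1 _; apply/andP; split; lra.
    have cw : continuous (fun w : C => cos (Im (iter (j + N) f w))).
      move=> w; apply: (@continuous_comp _ _ _ (fun w : C => Im (iter (j + N) f w)) (@cos R)).
        apply: (@continuous_comp _ _ _ (iter (j + N) f) Im); first exact: continuous_iter.
        exact: continuous_Im.
      exact: continuous_cos.
    move=> r; exact: (@continuous_comp _ _ _ (gam : subspace `[t, s] -> C)
      (fun w : C => cos (Im (iter (j + N) f w))) r (cts r) (cw _)).
  (* cos (Im (g j r)) would vanish somewhere between t and s *)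
  have [|r] := @IVT R (fun r => cos (Im (g j r))) t s 0 (ltW ts) cont.
    by rewrite ge_min le_max ct (ltW cs) orbT.
  rewrite in_itv /= => /andP[r1 r2] cr.
  have hr : t0 <= r < 1 by case/andP: ht => h1 h2; rewrite (le_trans h1 r1) (le_lt_trans r2).
  by have := c2 j r hr (IH r hr); rewrite cr; lra.
have [K /(_ K (leqnn K))] := basin_Re (domain_sub_basin hU (gU 0%N t0 t001)) 0.
rewrite /g add0n -iterD leNgt => /negP; apply.
apply: lt_trans (main K t0 _) _ ; last lra.
by rewrite lexx; move: t001; rewrite in_itv /= => /andP[].
Qed.

End Domain.
End NonAccessible.

(** * Surjectivity of the map on the half-strip *)

Section BranchReal.
Variable R : realType.
Implicit Types a b x y r : R.

(** The equation f(x + iy) = a + ib gives e^(- x) = r y from its imaginary part,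
and G y = a remains. *)
Lemma branch_IVT a b y1 y2 (m := Num.max b 0) (r := fun y => (y - b) / sin y)
   (G := fun y => - ln (r y) + r y * cos y) :
  m < y1 < pi -> m < y2 < pi -> a <= G y1 -> G y2 <= a ->
  exists x y, [/\ 0 < y < pi, fre x y = a & fim x y = b].
Proof.
move=> /andP[m1 p1] /andP[m2 p2] g1 g2.
pose l := Num.min y1 y2; pose u := Num.max y1 y2.
have ml : m < l by rewrite lt_min m1.
have up : u < pi by rewrite gt_max p1.
have lu : l <= u by rewrite ge_min le_max lexx.
have [mb m0] : b <= m /\ 0 <= m by rewrite /m !le_max !lexx orbT.
have sp y : m < y < pi -> 0 < sin y.
  by move=> /andP[h1 h2]; rewrite sin_gt0_pi// h2 (le_lt_trans m0).
have rp y : m < y < pi -> 0 < r y.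
  by move=> hy; rewrite divr_gt0 ?sp// subr_gt0 (le_lt_trans mb)//; case/andP: hy.
have cG : {within `[l, u], continuous G}.
  apply: continuous_in_subspaceT => y; rewrite inE /= in_itv /= => /andP[h1 h2].
  have hy : m < y < pi by rewrite (lt_le_trans ml h1) (le_lt_trans h2).
  have cr : r x @[x --> y] --> r y.
    apply: cvgM; first by apply: cvgB; [exact: cvg_id|exact: cvg_cst].
    by apply: cvgV; [rewrite gt_eqF// sp|exact: continuous_sin].
  apply: cvgD; last by apply: cvgM => //; exact: continuous_cos.
  apply: cvgN; apply: (@cvg_comp _ _ _ r (@ln R) _ _ _ cr).
  by apply: continuous_ln; exact: rp.
have [|y] := @IVT R G l u a lu cG.
  by rewrite /l /u; case: (leP y1 y2) => _; rewrite ge_min le_max ?g1 ?g2 ?orbT.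
rewrite in_itv /= => /andP[h1 h2] hG.
have hy : m < y < pi by rewrite (lt_le_trans ml h1) (le_lt_trans h2).
have er : expR (- - ln (r y)) = r y by rewrite opprK lnK// posrE rp.
exists (- ln (r y)), y; split; rewrite /fre /fim ?er//.
  by case/andP: hy => /(le_lt_trans m0) -> ->.
by rewrite /r divfK ?gt_eqF ?sp//; ring.
Qed.

Lemma near_right_pos (h : R -> R) a b : a < b -> h x @[x --> a] --> h a -> 0 < h a ->
  \forall x \near a^'+, a < x < b /\ 0 < h x.
Proof.
move=> ab ch h0; near=> x; split.
  by apply/andP; split; near: x; [exact: nbhs_right_gt|exact: nbhs_right_lt].
near: x; apply: cvg_within; apply: (ch [set x | 0 < x]); exact: lt_nbhsr.
Unshelve. all: by end_near. Qed.

Lemma near_left_pos (h : R -> R) a b : b < a -> h x @[x --> a] --> h a -> 0 < h a ->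
  \forall x \near a^'-, b < x < a /\ 0 < h x.
Proof.
move=> ab ch h0; near=> x; split.
  by apply/andP; split; near: x; [exact: nbhs_left_gt|exact: nbhs_left_lt].
near: x; apply: cvg_within; apply: (ch [set x | 0 < x]); exact: lt_nbhsr.
Unshelve. all: by end_near. Qed.

(** With r and G as in [branch_IVT]: in the interval ]max(b, 0), pi[, G -> - oo
at pi because r -> +oo and cos -> -1. At the left end, r -> +oo if b < 0 and r
-> 0 if b > 0, so that G -> +oo; if b = 0 then r -> 1 and G -> 1, which is why a
< 1 is assumed. *)
Lemma kepler_surj a b : `|b| < pi -> (b = 0 -> a < 1) ->
  exists x y, [/\ 0 < y < pi, fre x y = a & fim x y = b].
Proof.
rewrite ltr_norml => /andP[b1 b2] ab.
pose r y := (y - b) / sin y; pose G y := - ln (r y) + r y * cos y.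
have m2 : Num.max b 0 < pi by rewrite gt_max b2 pi_gt0.
have [mb m0] : b <= Num.max b 0 /\ 0 <= Num.max b 0 by rewrite !le_max !lexx orbT.
have cs := @continuous_sin R; have cc := @continuous_cos R.
have rp y : Num.max b 0 < y < pi -> 0 < sin y /\ 0 < r y.
  move=> /andP[h1 h2]; have sp : 0 < sin y by rewrite sin_gt0_pi// h2 (le_lt_trans m0).
  by split=> //; rewrite divr_gt0// subr_gt0 (le_lt_trans mb).
have lin (k : R) (y : R) : (x - b - k * sin x) @[x --> y] --> y - b - k * sin y.
  apply: cvgB; first by apply: cvgB; [exact: cvg_id|exact: cvg_cst].
  by apply: cvgM; [exact: cvg_cst|exact: cs].
have cc0 (k : R) : (cos x - k) @[x --> (0:R)] --> cos 0 - k.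
  by apply: cvgB; [exact: cc|exact: cvg_cst].
have [y2 hy2 g2] : exists2 y, Num.max b 0 < y < pi & G y <= a.
  (* r > K and cos y < - 1/2 give G y < - r / 2 <= a *)
  pose K := Num.max 1 (- 2 * a).
  have [K1 Ka] : 1 <= K /\ - 2 * a <= K by rewrite !le_max !lexx orbT.
  have p1 : 0 < pi - b - K * sin pi by rewrite sinpi; lra.
  have p2 : 0 < - (1 / 2) - cos pi :> R by rewrite cospi; lra.
  have c2 : (- (1 / 2) - cos x) @[x --> (pi : R)] --> - (1 / 2) - cos pi.
    by apply: cvgB; [exact: cvg_cst|exact: cc].
  have [y [[hy h1] [_ h2]]] :=
    filter_ex (filterI (near_left_pos m2 (lin K pi) p1) (near_left_pos m2 c2 p2)).
  exists y => //; have [sp ry] := rp y hy.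
  have rK : K < r y by rewrite ltr_pdivlMr//; lra.
  have l0 : 0 <= ln (r y) by rewrite ln_ge0//; lra.
  by rewrite /G; nra.
have [y1 hy1 g1] : exists2 y, Num.max b 0 < y < pi & a <= G y.
  have [b0|b0|b0] := ltgtP b 0.
  - rewrite (max_r (ltW b0)) in rp m2 *.
    (* G y >= - ln r + r / 2 >= r / 4 + 1 - ln 4, as ln (r / 4) <= r / 4 - 1 *)
    pose K := 4 * (a + ln 4).
    have p1 : 0 < 0 - b - K * sin 0 by rewrite sin0; lra.
    have p2 : 0 < cos 0 - 1 / 2 :> R by rewrite cos0; lra.
    have [y [[hy h1] [_ h2]]] :=
      filter_ex (filterI (near_right_pos m2 (lin K 0) p1) (near_right_pos m2 (cc0 _) p2)).
    exists y => //; have [sp ry] := rp y hy.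
    have rK : K < r y by rewrite ltr_pdivlMr//; lra.
    have l0 : ln (r y) <= ln 4 + (r y / 4 - 1).
      have -> : r y = 4 * (1 + (r y / 4 - 1)) by field.
      rewrite lnM ?posrE//; last lra.
      have h : 4 * (1 + (r y / 4 - 1)) / 4 - 1 = r y / 4 - 1 by field.
      by rewrite h lerD2l le_ln1Dx//; lra.
    by rewrite /G /K in rK *; nra.
  - rewrite (max_l (ltW b0)) in rp m2 *.
    (* r < e gives - ln r >= a + 1 and r cos y >= - 1 *)
    pose e := Num.min 1 (expR (- (a + 1))).
    have e0 : 0 < e by rewrite lt_min ltr01 expR_gt0.
    have [e1 ea] : e <= 1 /\ e <= expR (- (a + 1)) by rewrite !ge_min !lexx orbT.
    have sb : 0 < sin b by rewrite sin_gt0_pi// b0.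
    have p1 : 0 < - (b - b - e * sin b) by rewrite subrr sub0r opprK mulr_gt0.
    have [y [hy h1]] := filter_ex (near_right_pos m2 (cvgN (lin e b)) p1).
    exists y => //; have [sp ry] := rp y hy.
    have rK : r y < e by rewrite ltr_pdivrMr//; lra.
    have l0 : ln (r y) <= - (a + 1).
      by rewrite -[leRHS]expRK ler_ln ?posrE ?expR_gt0//; apply: ltW; exact: lt_le_trans ea.
    have c1 := cos_geN1 y.
    by rewrite /G; nra.
  - (* r <= 2 and ln r <= r - 1 give G y >= 1 - 2 (1 - cos y) *)
    move: (ab b0) => a1; subst b; rewrite maxxx in rp m2 *.
    have p1 : 0 < cos 0 - (1 + a) / 2 by rewrite cos0; lra.
    have p2 : 0 < cos 0 - 1 / 2 :> R by rewrite cos0; lra.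
    have [y [[hy h1] [_ h2]]] :=
      filter_ex (filterI (near_right_pos m2 (cc0 _) p1) (near_right_pos m2 (cc0 _) p2)).
    exists y => //; have [sp ry] := rp y hy.
    have [y0 yp] : 0 < y /\ y < pi by case/andP: hy.
    have s2 : y <= 2 * sin y.
      have [c] := @MVT R sin cos 0 y y0 (fun x _ => is_derive_sin x)
        (continuous_subspaceT (@continuous_sin R)).
      rewrite in_itv /= sin0 !subr0 => /andP[c0 cy] ->.
      have : cos y <= cos c by apply: ler_cos; lra.
      by nra.
    have r2 : r y <= 2 by rewrite ler_pdivrMr//; lra.
    have l0 : ln (r y) <= r y - 1.
      have {1}-> : r y = 1 + (r y - 1) by ring.
      by rewrite le_ln1Dx//; lra.
    have c1 := cos_le1 y.
    by rewrite /G; nra.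
exact: branch_IVT hy1 hy2 g1 g2.
Qed.
End BranchReal.

(** * Univalence and expansion on the half-strips *)

Section Branch.
Variable R : realType.
Local Notation C := (R[i]^o).
Local Notation Re := (@complex.Re R).
Local Notation Im := (@complex.Im R).
Local Notation f := (fbaker R).
Local Notation cj := (@cj R).
Implicit Types z w a b v : C.

Definition upper z := 0 < Im z < pi.
Definition dRe z := fdre (Re z) (Im z).
Definition dIm z := fdim (Re z) (Im z).
(** The squared modulus of the derivative of the map. *)
Definition dsq z := dRe z ^+ 2 + dIm z ^+ 2.
Definition segpt a b (t : R) : C := (Re a + t * (Re b - Re a)) +i* (Im a + t * (Im b - Im a)).

Lemma mean_value (p q : R) a b : exists2 t, 0 < t < 1 &
  p * Re (f b - f a) + q * Im (f b - f a) =
  p * (dRe (segpt a b t) * Re (b - a) - dIm (segpt a b t) * Im (b - a)) +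
  q * (dRe (segpt a b t) * Im (b - a) + dIm (segpt a b t) * Re (b - a)).
Proof.
have [t ht e] := mean_value_coord p q (Re a) (Im a) (Re b - Re a) (Im b - Im a).
exists t => //; rewrite !ReB !ImB !Re_f !Im_f /dRe /dIm /=.
by rewrite -e !subrKC.
Qed.

Lemma upper_segpt a b t : upper a -> upper b -> 0 <= t <= 1 -> upper (segpt a b t).
Proof.
rewrite /upper /= => /andP[a0 a1] /andP[b0 b1] /andP[t0 t1].
have [ab|ba] := leP (Im a) (Im b).
  have h1 : 0 <= t * (Im b - Im a) by rewrite mulr_ge0// subr_ge0.
  have h2 : 0 <= (1 - t) * (Im b - Im a) by rewrite mulr_ge0// subr_ge0.
  by apply/andP; split; lra.
have h1 : 0 <= t * (Im a - Im b) by rewrite mulr_ge0// subr_ge0 ltW.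
have h2 : 0 <= (1 - t) * (Im a - Im b) by rewrite mulr_ge0// subr_ge0// ltW.
by apply/andP; split; lra.
Qed.

Lemma upper_dIm z : upper z -> 0 < dIm z.
Proof. by move=> hz; rewrite mulr_gt0 ?expR_gt0// sin_gt0_pi. Qed.

(** (f b - f a) / (b - a) is a mean of f' over the segment, and Im f' > 0 on the
half-strip. *)
Lemma upper_im_mono a b : upper a -> upper b ->
  0 <= Re (b - a) * Im (f b - f a) - Im (b - a) * Re (f b - f a).
Proof.
move=> ha hb; have [t /andP[t0 t1] e] := mean_value (- Im (b - a)) (Re (b - a)) a b.
have /upper_dIm : upper (segpt a b t) by apply: upper_segpt => //; rewrite (ltW t0) ltW.
set I := dIm _ in e *; set D := dRe _ in e *.
have := sqr_ge0 (Re (b - a)); have := sqr_ge0 (Im (b - a)); nra.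
Qed.

Lemma open_gt_ball (h : C -> R) a (m : R) : h w @[w --> a] --> h a -> m < h a ->
  exists2 e : R, 0 < e & forall w, nrm (w - a) < e -> m < h w.
Proof.
move=> ch hm; have /nbhs_nrmP : nbhs a (h @^-1` [set x | m < x]).
  by apply: ch; exact: lt_nbhsr.
by case=> e e0 he; exists e.
Qed.

Lemma cvg_df a : (dRe w @[w --> a] --> dRe a) /\ (dIm w @[w --> a] --> dIm a).
Proof.
have hE := @cvg_expN_Re R a.
split; [exact: (cvgB (cvg_cst _) (cvgM hE (@cvg_cos_Im R a)))|].
exact: (cvgM hE (@cvg_sin_Im R a)).
Qed.

Lemma nrm_segpt a b t : nrm (segpt a b t - a) = `|t| * nrm (b - a).
Proof.
rewrite /nrm !ReB !ImB /=.
have -> : Re a + t * (Re b - Re a) - Re a = t * (Re b - Re a) by ring.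
have -> : Im a + t * (Im b - Im a) - Im a = t * (Im b - Im a) by ring.
by rewrite !exprMn -mulrDr sqrtrM ?sqr_ge0// sqrtr_sqr.
Qed.

(** The imaginary part of (f b - f a) / (b - a) is at least the contribution of
the beginning of the segment from a to b, where Im f' is bounded below; the rest
contributes nonnegatively, wherever b is. *)
Lemma upper_inverse_continuous a (rho : R) : upper a -> 0 < rho ->
  exists2 d : R, 0 < d & forall b, upper b -> nrm (f b - f a) < d -> nrm (b - a) < rho.
Proof.
move=> ha rho0; have dI := upper_dIm ha.
have [|e e0 he] := open_gt_ball (m := dIm a / 2) (cvg_df a).2; first lra.
pose r := Num.min rho e / 2.
have [r0 rr re] : [/\ 0 < r, r < rho & r < e].
  have m0 : 0 < Num.min rho e by rewrite lt_min rho0.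
  have [mr me] : Num.min rho e <= rho /\ Num.min rho e <= e by rewrite !ge_min !lexx orbT.
  by rewrite /r; split; lra.
exists (r * (dIm a / 2)); first by rewrite mulr_gt0// divr_gt0.
move=> b hb; rewrite !ltNge => /negP hd; apply/negP => hba; apply: hd.
set N := nrm (b - a) in hba *.
have N0 : 0 < N by lra.
(* the part of the segment from a to b inside the ball of radius r about a *)
pose t := r / N.
have t0 : 0 < t by rewrite divr_gt0.
have t1 : t < 1 by rewrite ltr_pdivrMr// mul1r (lt_le_trans rr).
pose b' := segpt a b t.
have hb' : upper b' by apply: upper_segpt => //; rewrite (ltW t0) ltW.
have e1 : Re (b' - a) = t * Re (b - a) /\ Im (b' - a) = t * Im (b - a).
  by rewrite !ReB !ImB /=; split; ring.
have e2 : Re (b - b') = (1 - t) * Re (b - a) /\ Im (b - b') = (1 - t) * Im (b - a).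
  by rewrite !ReB !ImB /=; split; ring.
have h1 := upper_im_mono hb' hb.
have [s /andP[s0 s1] h2] := mean_value (- Im (b - a)) (Re (b - a)) a b'.
have hI : dIm a / 2 < dIm (segpt a b' s).
  apply: he; rewrite nrm_segpt ger0_norm ?(ltW s0)//.
  rewrite /b' nrm_segpt (ger0_norm (ltW t0)) -/N /t divfK ?gt_eqF//; nra.
rewrite e1.1 e1.2 in h2; rewrite e2.1 e2.2 in h1.
set I := dIm (segpt a b' s) in h2 hI; set D := dRe _ in h2.
have hN : N ^+ 2 = Re (b - a) ^+ 2 + Im (b - a) ^+ 2 by rewrite nrm_sqr.
have h3 : t * N ^+ 2 = r * N by rewrite /t expr2 mulrA divfK ?gt_eqF.
have cs := cauchy_nrm ((- Im (b - a)) +i* Re (b - a)) (f b - f a).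
have eN : nrm ((- Im (b - a)) +i* Re (b - a)) = N by rewrite /N /nrm /= sqrrN addrC.
rewrite eN /= in cs.
have eR : Re (f b - f a) = Re (f b - f b') + Re (f b' - f a) by rewrite -ReD addrA subrK.
have eI : Im (f b - f a) = Im (f b - f b') + Im (f b' - f a) by rewrite -ImD addrA subrK.
have h1' : 0 <= Re (b - a) * Im (f b - f b') - Im (b - a) * Re (f b - f b').
  have t10 : 0 < 1 - t by lra.
  by rewrite -(pmulr_rge0 _ t10); lra.
have h4 : - Im (b - a) * Re (f b' - f a) + Re (b - a) * Im (f b' - f a) = I * (t * N ^+ 2).
  by rewrite h2 hN; ring.
have h5 : I * (r * N) <= N * nrm (f b - f a).
  by apply: le_trans cs; rewrite -h3 -h4 eR eI; lra.
have h6 : N * (I * r) <= N * nrm (f b - f a) by lra.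
rewrite ler_pM2l// in h6.
by apply: le_trans h6; rewrite mulrC ler_pM2r// ltW.
Qed.

(** The mean value theorem is applied in the direction of f'(a) (b - a), in
which f' at nearby points has component almost |f'(a)|. *)
Lemma local_expansion a (k : R) : 0 < k -> k ^+ 2 < dsq a ->
  exists2 e : R, 0 < e & forall b, nrm (b - a) < e -> k * nrm (b - a) <= nrm (f b - f a).
Proof.
move=> k0 hk; pose d : C := dRe a +i* dIm a.
have hd : nrm d ^+ 2 = dsq a by rewrite nrm_sqr.
have kd : k < nrm d.
  by rewrite -(ltr_pXn2r (n:=2)) ?nnegrE ?nrm_ge0 ?(ltW k0)// hd.
have [cR cI] := cvg_df a.
have [|e e0 he] := open_gt_ball (a := a) (m := k * nrm d)
  (h := fun w => dRe a * dRe w + dIm a * dIm w)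
  (cvgD (cvgM (cvg_cst _) cR) (cvgM (cvg_cst _) cI)).
  by rewrite -!expr2 -/(dsq a) -hd expr2 ltr_pM2r//; lra.
exists e => // b hb.
have [->|nba] := eqVneq b a.
  by rewrite subrr {1}/nrm /= expr0n /= addr0 sqrtr0 mulr0 nrm_ge0.
have N0 : 0 < nrm (b - a).
  rewrite lt_neqAle nrm_ge0 andbT eq_sym; apply/eqP => /nrm_eq0/eqP.
  by rewrite subr_eq0 (negPf nba).
(* the coordinates of f'(a) (b - a) *)
pose h : C := (dRe a * Re (b - a) - dIm a * Im (b - a)) +i*
  (dRe a * Im (b - a) + dIm a * Re (b - a)).
have [t /andP[t0 t1] e1] := mean_value (Re h) (Im h) a b.
have hh : nrm h = nrm d * nrm (b - a).
  rewrite /nrm -sqrtrM ?addr_ge0 ?sqr_ge0//=; congr Num.sqrt; ring.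
have cs := cauchy_nrm h (f b - f a).
have hq : k * nrm d < dRe a * dRe (segpt a b t) + dIm a * dIm (segpt a b t).
  apply: he; rewrite nrm_segpt ger0_norm ?(ltW t0)//; apply: le_lt_trans hb.
  by rewrite ler_piMl ?nrm_ge0 ?ltW.
rewrite e1 hh in cs.
have hN := nrm_sqr (b - a).
set N := nrm (b - a) in N0 hN cs *.
set D := dRe (segpt _ _ _) in cs hq; set I := dIm (segpt _ _ _) in cs hq.
have e2 : Re h * (D * Re (b - a) - I * Im (b - a)) + Im h * (D * Im (b - a) + I * Re (b - a)) =
  (dRe a * D + dIm a * I) * N ^+ 2 by rewrite hN /h /=; ring.
rewrite e2 in cs.
have h3 : (k * nrm d) * N ^+ 2 <= nrm d * N * nrm (f b - f a).
  by apply: le_trans cs; rewrite ler_wpM2r ?sqr_ge0// ltW.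
have d0 : 0 < nrm d by lra.
have h4 : (nrm d * N) * (k * N) <= (nrm d * N) * nrm (f b - f a) by apply: le_trans h3; lra.
by rewrite ler_pM2l ?mulr_gt0// in h4.
Qed.

Lemma upper_inj a b : upper a -> upper b -> f a = f b -> a = b.
Proof.
move=> ha hb e; apply/eqP; rewrite eq_sym -subr_eq0; apply/eqP; apply: nrm_eq0.
apply/eqP; rewrite eq_le nrm_ge0 andbT leNgt; apply/negP => n0.
have [d d0 /(_ b hb)] := upper_inverse_continuous ha n0.
rewrite e subrr {1}/nrm /= expr0n /= addr0 sqrtr0 => /(_ d0).
by rewrite ltxx.
Qed.

(** Curves are functions on R, of which only the restriction to [0, 1] matters.
*)
Definition lip (l : R) (c : R -> C) :=
  forall s t : R, 0 <= s <= 1 -> 0 <= t <= 1 -> nrm (c s - c t) <= l * `|s - t|.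

Lemma lipW (l l' : R) c : l <= l' -> lip l c -> lip l' c.
Proof.
move=> ll h s t hs ht; apply: le_trans (h s t hs ht) _.
by rewrite ler_wpM2r.
Qed.

(** A bound on the local stretch at every point integrates to a bound on the
interval: the points up to which the bound holds form a closed set without a
last element before 1. *)
Lemma local_lip (l : R) (c : R -> C) :
  (forall t : R, 0 <= t <= 1 -> exists2 e : R, 0 < e &
     forall s : R, 0 <= s <= 1 -> `|s - t| < e -> nrm (c s - c t) <= l * `|s - t|) -> lip l c.
Proof.
move=> loc.
suff main (a b : R) : 0 <= a -> a <= b -> b <= 1 -> nrm (c b - c a) <= l * (b - a).
  move=> s t /andP[s0 s1] /andP[t0 t1]; have [st|ts] := leP s t.
    by rewrite nrmB distrC ger0_norm ?subr_ge0//; exact: main.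
  by rewrite ger0_norm ?subr_ge0 ?(ltW ts)//; apply: main => //; exact: ltW.
move=> a0 ab b1.
pose E := [set t | a <= t <= b /\ nrm (c t - c a) <= l * (t - a)].
have Ea : E a by split; rewrite ?lexx ?ab// !subrr mulr0 /nrm /= expr0n /= addr0 sqrtr0.
have hE : has_sup E by split; [exists a|exists b => t [/andP[]]].
pose s := sup E.
have as_ : a <= s by apply: sup_upper_bound.
have sb : s <= b by apply: ge_sup; [exists a|move=> t [/andP[]]].
have s01 : 0 <= s <= 1 by apply/andP; split; lra.
have [e e0 he] := loc s s01.
have Es : nrm (c s - c a) <= l * (s - a).
  have [t [tE1 tE2] st] := sup_adherent e0 hE.
  rewrite -/s in st.
  have ts : t <= s by apply: sup_upper_bound.
  have t01 : 0 <= t <= 1 by case/andP: tE1 => h1 h2; apply/andP; split; lra.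
  have := he t t01; rewrite distrC ger0_norm ?subr_ge0// => h.
  have {h} := h _; rewrite nrmB => h.
  apply: le_trans (nrm_dist _ _ (c t)) _.
  have : nrm (c s - c t) <= l * (s - t) by apply: h; lra.
  lra.
move: sb; rewrite le_eqVlt => /orP[/eqP <- //|sb].
exfalso; pose u := Num.min b (s + e / 2).
have [ub ue] : u <= b /\ u <= s + e / 2 by rewrite !ge_min !lexx orbT.
have su : s < u by rewrite lt_min sb ltrDl divr_gt0.
have u01 : 0 <= u <= 1 by apply/andP; split; lra.
have := he u u01; rewrite ger0_norm ?subr_ge0 ?(ltW su)// => h.
have hu : nrm (c u - c s) <= l * (u - s) by apply: h; lra.
suff : u <= s by lra.
apply: sup_upper_bound => //; split; first by apply/andP; split; lra.
by apply: le_trans (nrm_dist _ _ (c s)) _; lra.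
Qed.

(** The lift is continuous by [upper_inverse_continuous], so [local_expansion]
applies between nearby parameters and gives the local bound that [local_lip]
integrates. *)
Lemma lift_lip_upper (l k : R) (c xi : R -> C) : 0 < k -> 0 <= l -> lip l c ->
  (forall t : R, 0 <= t <= 1 -> [/\ upper (xi t), f (xi t) = c t & k ^+ 2 < dsq (xi t)]) ->
  lip (l / k) xi.
Proof.
move=> k0 l0 lc hxi; apply: local_lip => t ht.
have [ut ft dt] := hxi t ht.
have [e e0 he] := local_expansion k0 dt.
have [d d0 hd] := upper_inverse_continuous ut e0.
exists (d / (l + 1)); first by rewrite divr_gt0//; lra.
move=> s hs; rewrite ltr_pdivlMr; last lra.
move=> st; have [us fs _] := hxi s hs.
have h1 := lc s t hs ht.
have h2 := normr_ge0 (s - t).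
rewrite mulrAC ler_pdivlMr// mulrC.
apply: le_trans (he _ _) _; first by apply: hd => //; rewrite fs ft; nra.
by rewrite fs ft.
Qed.

Definition halfstrip (s : bool) z := if s then upper z else upper (cj z).

Lemma dsq_cj z : dsq (cj z) = dsq z.
Proof. by rewrite /dsq /dRe /dIm /fdre /fdim /= cosN sinN; ring. Qed.

Lemma lift_lip (s : bool) (l k : R) (c xi : R -> C) : 0 < k -> 0 <= l -> lip l c ->
  (forall t : R, 0 <= t <= 1 -> [/\ halfstrip s (xi t), f (xi t) = c t & k ^+ 2 < dsq (xi t)]) ->
  lip (l / k) xi.
Proof.
case: s => k0 l0 lc hxi; first exact: lift_lip_upper hxi.
have lcj m (g : R -> C) : lip m g -> lip m (cj \o g).
  by move=> lg s t hs ht; rewrite /= cjB nrm_cj; exact: lg.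
have : lip (l / k) (cj \o xi).
  apply: (@lift_lip_upper l k (cj \o c)) => //; first exact: lcj.
  by move=> t ht; have [h1 h2 h3] := hxi t ht; split; rewrite /= ?cj_f ?h2 ?dsq_cj.
move=> /lcj h s t hs ht; have := h s t hs ht.
by rewrite /= !cjK.
Qed.

End Branch.

(** * Inverse branches outside the petal *)

Section Outer.
Variable R : realType.
Local Notation C := (R[i]^o).
Local Notation Re := (@complex.Re R).
Local Notation Im := (@complex.Im R).
Local Notation f := (fbaker R).
Local Notation cj := (@cj R).
Local Notation basin := (@basin R).
Implicit Types z w a b v : C.

(** The open strip without the part x > 0 of the petal. The half-strip x <= 0
makes room for the paths below, and its preimages are expanded as well: see
[expansion]. *)
Definition outer z := `|Im z| < pi /\ (Re z <= 0 \/ 2 * cos (Im z) <= expR (- Re z)).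

Lemma dsqE z : dsq z = 1 + expR (- Re z) * (expR (- Re z) - 2 * cos (Im z)).
Proof.
rewrite /dsq /dRe /dIm /fdre /fdim; have := cos2Dsin2 (Im z).
set c := cos _; set s := sin _; set r := expR _ => h.
have -> : (1 - r * c) ^+ 2 + (r * s) ^+ 2 = 1 - 2 * (r * c) + r ^+ 2 * (c ^+ 2 + s ^+ 2) by ring.
by rewrite h; ring.
Qed.

(** Points with r > 2 and |f'| close to 1 are near - ln 2, modulo 2 pi i, and
the map sends a neighbourhood of - ln 2 into the petal. *)
Lemma petal_near_two (r y : R) : 2 < r -> r * (r - 2 * cos y) < 1 / 8 ->
  r * expR (- (r * cos y)) < 2 * cos (y - r * sin y).
Proof.
move=> r2 h; set c := cos y in h *; set s := sin y.
have c1 : c <= 1 := cos_le1 y.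
have h1 : r - 2 * c < 1 / 16 by nra.
have h2 : r < 33 / 16 by lra.
have h3 : 31 / 32 < c by lra.
have h4 : s ^+ 2 < 1 / 16 by have := cos2Dsin2 y; rewrite -/c -/s; nra.
have rs2 : (r * s) ^+ 2 < 7 / 25 by rewrite exprMn; have := sqr_ge0 s; nra.
have crs : 43 / 50 <= cos (r * s).
  rewrite -cos_norm; apply: le_trans (cos_ge_quad (normr_ge0 _)).
  by rewrite real_normK ?num_real//; lra.
have srs : 0 <= s * sin (r * s).
  have p3 := pi_ge2 R.
  have rs1 : `|r * s| <= pi.
    rewrite -(ler_pXn2r (n:=2)) ?nnegrE ?pi_ge0//.
    by rewrite real_normK ?num_real//; nra.
  have [s0|s0] := leP 0 s.
    rewrite mulr_ge0// sin_ge0_pi// mulr_ge0//=; last lra.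
    by apply: le_trans rs1; exact: ler_norm.
  have -> : s * sin (r * s) = - s * sin (r * - s) by rewrite mulrN sinN; ring.
  have rs0 : 0 <= r * - s by rewrite mulr_ge0//; lra.
  rewrite mulr_ge0//; first lra.
  rewrite sin_ge0_pi// rs0 /=; apply: le_trans rs1.
  by rewrite mulrN -normrN; exact: ler_norm.
have cy : 83 / 100 <= cos (y - r * s) by rewrite cosB -/c -/s; nra.
have rc : 31 / 16 <= r * c by nra.
have rc0 : 0 <= r * c by lra.
have e1 := expR_inv_bound rc0; have e0 := expR_gt0 (- (r * c)).
nra.
Qed.

(** |f'|^2 = 1 + r (r - 2 c) with c = cos y. If Re f(z) <= 0 then r c <= - x <=
r - 1 and r (r - 2 c) >= 1. Otherwise f(z) lies outside the petal; for r <= 2,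
|y| does not increase and this reads 2 c <= r e^(- r c), so that r - 2 c >= 2 r
c^2, a bound which is effective unless c is small compared with r, and then r -
2 c itself is large. The bound on Re z keeps r away from 0, that is, from the
parabolic behaviour at +oo. *)
Lemma expansion (X : R) : exists2 k : R, 1 < k &
  forall z, `|Im z| <= pi -> Re z <= X -> outer (f z) -> k ^+ 2 < dsq z.
Proof.
pose a := Num.min 1 (expR (- X)).
have a0 : 0 < a by rewrite lt_min ltr01 expR_gt0.
have [a1 aX] : a <= 1 /\ a <= expR (- X) by rewrite !ge_min !lexx orbT.
have a4 : a ^+ 4 <= 1 by apply: exprn_ile1 => //; exact: ltW.
have a40 : 0 < a ^+ 4 by rewrite exprn_gt0.
(* k^2 < 1 + a^4 / 8 *)
exists (1 + a ^+ 4 / 64); first by rewrite ltrDl divr_gt0.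
move=> z iz rX [iy oz]; rewrite dsqE.
suff main : a ^+ 4 / 8 <= expR (- Re z) * (expR (- Re z) - 2 * cos (Im z)) by nra.
have ra : a <= expR (- Re z) by apply: le_trans aX _; rewrite ler_expR lerN2.
have lnr := expR_ge1Dx (- Re z).
move: oz iy; rewrite Re_f Im_f /fre /fim.
set r := expR (- Re z) in ra lnr *; set c := cos (Im z) => oz iy.
have r0 : 0 < r by lra.
have a24 : a ^+ 4 <= a ^+ 2 by apply: ler_wiXn2l => //; exact: ltW.
have ar2 : a ^+ 2 <= r ^+ 2 by apply: lerXn2r => //; rewrite ?nnegrE ltW.
have ar4 : a ^+ 4 <= r ^+ 4 by apply: lerXn2r => //; rewrite ?nnegrE ltW.
case: oz => [oz|oz]; first nra.
have [cr|cr] := leP c (r / 4).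
  have : r * (r / 2) <= r * (r - 2 * c) by rewrite ler_pM2l//; lra.
  lra.
have rc0 : 0 <= r * c by rewrite mulr_ge0//; lra.
have e1 := expR_inv_bound rc0; have e0 := expR_gt0 (- (r * c)).
have eX : expR (- (Re z + r * c)) = r * expR (- (r * c)) by rewrite opprD expRD.
rewrite eX in oz.
have [r2|r2] := leP r 2; last first.
  have [|h] := leP (1 / 8) (r * (r - 2 * c)); first lra.
  by have := petal_near_two r2 h; rewrite -/c ltNge oz.
have hc : c <= cos (Im z - r * sin (Im z)).
  by apply: ler_cos_norm => //; apply: kepler_norm => //; rewrite ltW.
have h1 : 2 * c * (1 + r * c) <= r.
  have h2 : 2 * c <= r * expR (- (r * c)) by lra.
  apply: le_trans (_ : r * (expR (- (r * c)) * (1 + r * c)) <= _); last by rewrite ler_piMr// ltW.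
  by rewrite mulrA ler_wpM2r//; lra.
have h3 : 2 * (r * c) ^+ 2 <= r * (r - 2 * c) by nra.
have h4 : (r * (r / 4)) ^+ 2 <= (r * c) ^+ 2.
  have rr : 0 <= r * (r / 4) by rewrite mulr_ge0//; lra.
  by apply: lerXn2r; rewrite ?nnegrE// ler_pM2l// ltW.
have h5 : (r * (r / 4)) ^+ 2 = r ^+ 4 / 16 by field.
lra.
Qed.

Lemma halfstrip_im s z : halfstrip s z -> 0 < `|Im z| < pi.
Proof.
case: s; rewrite /halfstrip /upper /= => /andP[h1 h2].
  by rewrite ger0_norm ?h1 ?(ltW h1).
by rewrite -normrN ger0_norm ?h1 ?(ltW h1).
Qed.

Lemma outer_preimage s z : halfstrip s z -> outer (f z) -> outer z.
Proof.
move=> /halfstrip_im/andP[_ iz] [iy oy]; split=> //.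
have [|rz] := leP (Re z) 0; first by left.
right; rewrite leNgt; apply/negP => hp.
have pz : petal z by split.
have [[_ h1] _ h2] := petal_step pz.
case: oy => [|h3]; last lra.
rewrite h2 => h3; have r0 := expR_gt0 (- Re z).
have c0 : 0 < cos (Im z) by lra.
by have := mulr_gt0 r0 c0; lra.
Qed.

Lemma outer_cj z : outer (cj z) <-> outer z.
Proof. by rewrite /outer /= normrN cosN. Qed.

Lemma upper_branch_exists z : outer z -> exists w, upper w /\ f w = z.
Proof.
case=> iz oz.
have [|x [y [hy h1 h2]]] := @kepler_surj R (Re z) (Im z) iz.
  move=> i0; case: oz => [|]; first lra.
  rewrite i0 cos0 mulr1 => h; rewrite ltNge; apply/negP => r1.
  have : expR (- Re z) <= 1 by rewrite expR_le1; lra.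
  lra.
by exists (x +i* y); split=> //; apply: complexP; rewrite ?Re_f ?Im_f.
Qed.

Definition upper_branch z : C := xget 0 [set w | upper w /\ f w = z].
(** Meaningful on [outer], which avoids the slit [1, +oo[ because the positive
real axis lies in the petal. *)
Definition branch (s : bool) z : C := if s then upper_branch z else cj (upper_branch (cj z)).

Lemma upper_branchP z : outer z -> upper (upper_branch z) /\ f (upper_branch z) = z.
Proof. by move=> /upper_branch_exists; exact: xgetPex. Qed.

Lemma branchP s z : outer z ->
  [/\ halfstrip s (branch s z), f (branch s z) = z & outer (branch s z)].
Proof.
move=> oz.
have [hb fb] : halfstrip s (branch s z) /\ f (branch s z) = z.
  case: s => /=; first exact: upper_branchP.
  by have /outer_cj/upper_branchP[h1 h2] := oz; rewrite cjK cj_f h2 cjK.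
by split=> //; apply: (outer_preimage hb); rewrite fb.
Qed.

Lemma halfstrip_inj s a b : halfstrip s a -> halfstrip s b -> f a = f b -> a = b.
Proof.
case: s => /= ha hb e; first exact: upper_inj.
by apply: (can_inj (@cjK R)); apply: upper_inj => //; rewrite !cj_f e.
Qed.

Lemma branchK s z : halfstrip s z -> outer (f z) -> branch s (f z) = z.
Proof. by move=> hz oz; have [h1 h2 _] := branchP s oz; apply: (halfstrip_inj h1). Qed.

(** The real number with e^(- x) = pi / 2. By e^(- x) sin(pi / 2) = pi / 2, the
points i pi / 2 above and below it are its two preimages in the strip. *)
Definition basept : R := - ln (pi / 2).
(** The vertical segment from the base point to its preimage in the upper or in
the lower half-strip. *)
Definition crossbar (s : bool) (t : R) : C := basept +i* ((if s then 1 else -1) * (t * (pi / 2))).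

Lemma basept_le0 : basept <= 0.
Proof. by rewrite oppr_le0 ln_ge0// pihalf_ge1. Qed.

Lemma expRN_basept : expR (- basept) = pi / 2.
Proof. by rewrite opprK lnK// posrE; have := pihalf_ge1 R; lra. Qed.

Lemma crossbar_Im s t : 0 <= t <= 1 -> `|Im (crossbar s t)| < pi.
Proof.
move=> /andP[t0 t1] /=; have p0 := pi_gt0 R.
have -> : `|(if s then 1 else -1) * (t * (pi / 2))| = t * (pi / 2).
  by case: s; rewrite ?mul1r ?mulN1r ?normrN ger0_norm// mulr_ge0//; lra.
nra.
Qed.

Lemma crossbar_outer s t : 0 <= t <= 1 -> outer (crossbar s t).
Proof. by move=> t01; split; [exact: crossbar_Im|left; exact: basept_le0]. Qed.

Lemma crossbar_lip s : lip (pi / 2) (crossbar s).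
Proof.
move=> t u _ _; apply: le_trans (nrm_le_sum _) _; rewrite ReB ImB /= subrr normr0 add0r.
have h0 : 0 <= pi / 2 :> R by have := pi_gt0 R; lra.
move: (pi / 2 : R) h0 => h h0; rewrite -mulrBr -mulrBl !normrM (ger0_norm h0).
by case: s; rewrite ?normrN normr1 mul1r mulrC.
Qed.

Lemma crossbar0 s : crossbar s 0 = basept%:C.
Proof. by apply: complexP => //=; rewrite mul0r mulr0. Qed.

Lemma crossbar1 s : crossbar s 1 = branch s basept%:C.
Proof.
have p0 := pi_gt0 R.
have oq : outer basept%:C by rewrite -(crossbar0 s); apply: crossbar_outer; rewrite lexx ler01.
have [h1 h2 _] := branchP s oq.
apply: (halfstrip_inj _ h1); last first.
  rewrite h2; apply: complexP; rewrite ?Re_f ?Im_f /fre /fim /= expRN_basept mul1r.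
    by case: s {h1 h2}; rewrite ?mul1r ?mulN1r ?cosN cos_pihalf mulr0 addr0.
  by case: s {h1 h2}; rewrite ?mul1r ?mulN1r ?sinN sin_pihalf; ring.
by case: s {h1 h2}; rewrite /halfstrip /upper /=; apply/andP; split; lra.
Qed.

(** This says that the map sends the crossbar into the petal. The imaginary part
of the image is at most y and at most t - y in modulus, so its cosine is at
least max(cos y, sin y). *)
Lemma crossbar_petal (t y : R) : t = pi / 2 -> 0 <= y <= t ->
  t * expR (- (t * cos y)) < 2 * cos (y - t * sin y) /\ `|y - t * sin y| < pi.
Proof.
move=> tE /andP[y0 yt].
have [t1 t2] : 1 <= t /\ t < 2 by rewrite tE; split; [exact: pihalf_ge1|exact: pihalf_lt2].
have pE : pi = 2 * t by rewrite tE; field.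
have c0 : 0 <= cos y by apply: cos_ge0_pihalf; rewrite -tE; lra.
have s0 : 0 <= sin y by apply: sin_ge0_pi; lra.
have c1 := cos_le1 y; have s1 := sin_le1 y; have cs := cos2Dsin2 y.
have hc : cos y <= cos (y - t * sin y).
  by apply: ler_cos_norm; [apply: kepler_norm|]; rewrite ?ger0_norm//; lra.
have yn : `|y - t * sin y| <= y.
  by rewrite -[leRHS]ger0_norm//; apply: kepler_norm; rewrite ?ger0_norm//; lra.
have hs : sin y <= cos (y - t * sin y).
  have sE : sin y = cos (t - y) by rewrite tE cosB cos_pihalf sin_pihalf; ring.
  have ty0 : 0 <= t - y by lra.
  have h := cos_ge_quad ty0; rewrite -sE in h.
  rewrite {1}sE; apply: ler_cos_norm; rewrite (ger0_norm ty0); last lra.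
  by rewrite ler_norml; apply/andP; split; nra.
split; last by lra.
set m := cos (y - _) in hc hs *; set c := cos y in c0 c1 cs hc *; set s := sin y in s0 s1 cs hs.
have tc0 : 0 <= t * c by rewrite mulr_ge0//; lra.
have e1 := expR_inv_bound tc0; have e0 := expR_gt0 (- (t * c)).
suff h : t < 2 * m * (1 + t * c).
  have tc1 : 0 < 1 + t * c by lra.
  rewrite -(ltr_pM2r tc1); apply: le_lt_trans h.
  by rewrite -mulrA ler_piMr//; lra.
have [c4|c4] := leP (1 / 4) c.
  have m7 : 7 / 10 <= m by rewrite leNgt; apply/negP => m7; nra.
  have tc : t / 4 <= t * c by nra.
  have : 7 / 5 * (1 + t / 4) <= 2 * m * (1 + t * c) by apply: ler_pM; lra.
  by lra.
have s9 : 9 / 10 <= s by nra.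
have sc : 1 <= s * (1 + c).
  rewrite -(ler_pXn2r (n:=2)) ?nnegrE ?mulr_ge0//; last lra.
  rewrite expr1n exprMn; have -> : s ^+ 2 = 1 - c ^+ 2 by lra.
  have c2 : c ^+ 2 <= c / 4 by nra.
  have c3 : 0 <= c ^+ 2 := sqr_ge0 c.
  have -> : (1 - c ^+ 2) * (1 + c) ^+ 2 = 1 + 2 * c - 2 * c * c ^+ 2 - c ^+ 2 * c ^+ 2 by ring.
  have h1 : c * c ^+ 2 <= c / 4 by nra.
  have h2 : c ^+ 2 * c ^+ 2 <= c / 4 by nra.
  lra.
have h1 : s * (1 + c) <= m * (1 + t * c).
  have ct : c <= t * c by nra.
  by apply: ler_pM; lra.
lra.
Qed.

Lemma crossbar_basin s t : 0 <= t <= 1 -> basin (crossbar s t).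
Proof.
move=> /andP[t0 t1]; exists 1%N => /=.
have p0 := pi_gt0 R.
have [|h1 h2] := @crossbar_petal (pi / 2) (t * (pi / 2)) erefl; first by apply/andP; split; nra.
have e : [/\ cos (Im (f (crossbar s t))) = cos (t * (pi / 2) - pi / 2 * sin (t * (pi / 2))),
   `|Im (f (crossbar s t))| = `|t * (pi / 2) - pi / 2 * sin (t * (pi / 2))| &
   Re (f (crossbar s t)) = basept + pi / 2 * cos (t * (pi / 2))].
  rewrite Re_f Im_f /fre /fim /= expRN_basept; case: s; rewrite ?mul1r ?mulN1r ?sinN ?cosN //.
  set y := t * _; have -> : - y - pi / 2 * - sin y = - (y - pi / 2 * sin y) by ring.
  by rewrite cosN normrN.
case: e => e1 e2 e3; split; first by rewrite e2.
by rewrite e1 e3 opprD expRD expRN_basept.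
Qed.

End Outer.

(** * Pulling curves back along an orbit *)

Section Access.
Variable R : realType.
Local Notation C := (R[i]^o).
Local Notation Re := (@complex.Re R).
Local Notation Im := (@complex.Im R).
Local Notation f := (fbaker R).
Local Notation basin := (@basin R).
Local Notation outer := (@outer R).
Local Notation basept := (@basept R).
Implicit Types w a b v : C.
Implicit Types z : nat -> C.
Implicit Types s : nat -> bool.

(** When s codes the orbit of v, this is the branch of the n-th inverse iterate
that sends f^n(v) back to v. *)
Fixpoint pullback s n w : C :=
  if n is n'.+1 then branch (s 0%N) (pullback (fun i => s i.+1) n' w) else w.

Lemma pullbackSr s n w : pullback s n.+1 w = pullback s n (branch (s n) w).
Proof. by elim: n s => //= n IH s; congr branch; exact: IH. Qed.

Lemma pullback_outer s n w : outer w -> outer (pullback s n w).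
Proof. by elim: n s => //= n IH s ow; have [] := branchP (s 0%N) (IH (fun i => s i.+1) ow). Qed.

Lemma pullback_basin s n w : outer w -> basin w -> basin (pullback s n w).
Proof.
move=> ow bw; elim: n s => //= n IH s.
have [_ h _] := branchP (s 0%N) (pullback_outer (fun i => s i.+1) n ow).
by apply: basin_f; rewrite h.
Qed.

(** What is used of the orbit of a boundary point with bounded orbit. It does
not refer to the boundary, and is inherited by the tails of the orbit. *)
Definition coded (A : R) z s := forall n,
  [/\ halfstrip (s n) (z n), f (z n) = z n.+1, outer (z n) & `|Re (z n)| <= A].

Lemma coded_shift A z s j : coded A z s -> coded A (fun i => z (j + i)%N) (fun i => s (j + i)%N).
Proof. by move=> h n; have [] := h (j + n)%N; rewrite -addnS. Qed.

Lemma pullback_orbit A z s n : coded A z s -> pullback s n (z n) = z 0%N.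
Proof.
elim: n z s => //= n IH z s h.
have -> : pullback (fun i => s i.+1) n (z n.+1) = z 1%N.
  exact: (IH (fun i => z i.+1) (fun i => s i.+1) (coded_shift 1%N h)).
have [h1 h2 _ _] := h 0%N; have [_ _ o1 _] := h 1%N.
by rewrite -h2 branchK // h2.
Qed.

(** At every level the curve is first seen to be no longer than L, as |f'| > 1
on preimages of [outer]; it starts within L of the orbit, so it lies in the
half-plane x <= A + 2 L, where the contraction is uniform. *)
Lemma pullback_lip (A L k : R) : 1 < k -> 0 <= L ->
  (forall w, `|Im w| <= pi -> Re w <= A + 2 * L -> outer (f w) -> k ^+ 2 < dsq w) ->
  forall n z s (c : R -> C), coded A z s -> lip L c ->
  (forall t : R, 0 <= t <= 1 -> outer (c t)) ->
  (forall j, (j <= n)%N -> nrm (pullback (fun i => s (j + i)%N) (n - j) (c 0) - z j) <= L) ->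
  lip (L / k ^+ n) (fun t => pullback s n (c t)).
Proof.
move=> k1 L0 hk; elim=> [|n IH] z s c hc lc oc anc; first by rewrite expr0 divr1.
have k0 : 0 < k by lra.
have kn : 1 <= k ^+ n by rewrite exprn_ege1// ltW.
pose c1 t := pullback (fun i => s i.+1) n (c t).
have lc1 : lip (L / k ^+ n) c1.
  have hc1 : coded A (fun i => z i.+1) (fun i => s i.+1) := coded_shift 1%N hc.
  apply: (IH (fun i => z i.+1) (fun i => s i.+1) c hc1 lc oc).
  by move=> j jn; have := anc j.+1 jn; rewrite subSS.
have oc1 (t : R) : 0 <= t <= 1 -> outer (c1 t) by move=> /oc; exact: pullback_outer.
have lL : 0 <= L / k ^+ n by rewrite divr_ge0// ltW// (lt_le_trans ltr01).
have brT t (ht : 0 <= t <= 1) := branchP (s 0%N) (oc1 t ht).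
have imT (t : R) : 0 <= t <= 1 -> `|Im (branch (s 0%N) (c1 t))| <= pi.
  by move=> /brT[/halfstrip_im/andP[_ /ltW]].
have l1 : lip L (fun t => branch (s 0%N) (c1 t)).
  have -> : L = L / 1 by rewrite divr1.
  apply: (@lift_lip _ (s 0%N) L 1 c1) => //.
    by apply: lipW lc1; rewrite ler_piMr// invf_le1// (lt_le_trans ltr01).
  move=> t ht; have [h1 h2 h3] := brT t ht; split=> //.
  have [k' k'1 hk'] := expansion (Re (branch (s 0%N) (c1 t))).
  have := hk' _ (imT t ht) (lexx _); rewrite h2 => /(_ (oc1 t ht)).
  by rewrite expr1n; nra.
rewrite exprSr invfM mulrA; apply: (@lift_lip _ (s 0%N) _ k c1) => //.
move=> t ht; have [h1 h2 h3] := brT t ht; split=> //.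
apply: hk; [exact: imT| |by rewrite h2; exact: oc1].
have h0 : nrm (branch (s 0%N) (c1 0) - z 0%N) <= L := anc 0%N (leq0n _).
have h4 : nrm (branch (s 0%N) (c1 t) - branch (s 0%N) (c1 0)) <= L.
  apply: le_trans (l1 t 0 ht _) _; first by rewrite lexx ler01.
  by case/andP: ht => t0 t1; rewrite subr0 ger0_norm// ler_piMr.
have [_ _ _ zA] := hc 0%N.
have h5 := nrm_dist (branch (s 0%N) (c1 t)) (z 0%N) (branch (s 0%N) (c1 0)).
have h6 := Re_le_nrm (branch (s 0%N) (c1 t) - z 0%N).
rewrite ReB in h6; have h7 := ler_norm (Re (branch (s 0%N) (c1 t)) - Re (z 0%N)).
have h8 := ler_norm (Re (z 0%N)).
lra.
Qed.

Lemma bernoulli (k : R) n : 1 < k -> 1 + n%:R * (k - 1) <= k ^+ n.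
Proof.
move=> k1; elim: n => [|n IH]; first by rewrite mul0r addr0 expr0.
rewrite exprS -natr1; have n0 : 0 <= n%:R * (k - 1) ^+ 2 by rewrite mulr_ge0// sqr_ge0.
have : k * (1 + n%:R * (k - 1)) <= k * k ^+ n by rewrite ler_pM2l//; lra.
lra.
Qed.

(** Horizontal for t <= 1/2 and vertical after that, because [outer] is stable
under leftward moves and contains the half-strip x <= 0. *)
Definition corner w (t : R) : C :=
  (basept + (Re w - basept) * Num.max 0 (1 - 2 * t)) +i* (Im w * Num.min 1 (2 - 2 * t)).

Lemma corner0 w : corner w 0 = w.
Proof.
by apply: complexP => /=; rewrite mulr0 subr0 ?(max_r ler01) ?min_l ?mulr1//; [ring|lra].
Qed.

Lemma corner1 w : corner w 1 = basept%:C.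
Proof.
apply: complexP => /=.
  by rewrite max_l; [ring|lra].
by rewrite min_r; [ring|lra].
Qed.

Lemma corner_outer w (t : R) : 0 <= t <= 1 -> outer w -> outer (corner w t).
Proof.
move=> /andP[t0 t1] [iw ow].
have q0 := basept_le0 R.
set m := Num.max 0 (1 - 2 * t); set u := Num.min 1 (2 - 2 * t).
have u0 : 0 <= u by rewrite le_min ler01; lra.
have u1 : u <= 1 by rewrite ge_min lexx.
have m0 : 0 <= m by rewrite le_max lexx.
have m1 : m <= 1 by rewrite ge_max ler01; lra.
split.
  rewrite /= -/u normrM (ger0_norm u0); apply: le_lt_trans iw.
  by rewrite ler_piMr.
rewrite /= -/m -/u.
have [r0|r0] := leP (basept + (Re w - basept) * m) 0; first by left.
right.
have mpos : 0 < m by rewrite lt_neqAle m0 andbT eq_sym; apply/eqP => e; rewrite e mulr0 in r0; lra.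
have u1' : u = 1.
  have t2 : 0 < 1 - 2 * t.
    rewrite ltNge; apply/negP => h; move: mpos; rewrite /m max_l//; lra.
  by rewrite /u min_l//; lra.
have rw : basept + (Re w - basept) * m <= Re w by nra.
rewrite u1' mulr1; case: ow => [|h]; first lra.
by apply: le_trans h _; rewrite ler_expR lerN2.
Qed.

Lemma corner_lip (A : R) w : `|Re w| <= A -> outer w ->
  lip (2 * (A + `|basept|) + 2 * pi) (corner w).
Proof.
move=> rA [iw _] t u _ _; apply: le_trans (nrm_le_sum _) _; rewrite ReB ImB /=.
have e1 : basept + (Re w - basept) * Num.max 0 (1 - 2 * t) -
  (basept + (Re w - basept) * Num.max 0 (1 - 2 * u)) =
  (Re w - basept) * (Num.max 0 (1 - 2 * t) - Num.max 0 (1 - 2 * u)) by ring.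
rewrite e1 -(mulrBr (Im w)).
have hx : `|Num.max 0 (1 - 2 * t) - Num.max 0 (1 - 2 * u)| <= 2 * `|t - u|.
  have [h|h] := leP 0 (t - u); rewrite ?(ger0_norm h) ?(ltr0_norm h) ler_norml;
    case: (leP 0 (1 - 2 * t)) => ?; case: (leP 0 (1 - 2 * u)) => ?; apply/andP; split; lra.
have hy : `|Num.min 1 (2 - 2 * t) - Num.min 1 (2 - 2 * u)| <= 2 * `|t - u|.
  have [h|h] := leP 0 (t - u); rewrite ?(ger0_norm h) ?(ltr0_norm h) ler_norml;
    case: (leP 1 (2 - 2 * t)) => ?; case: (leP 1 (2 - 2 * u)) => ?; apply/andP; split; lra.
have h2 : `|Re w - basept| <= A + `|basept| by apply: le_trans (ler_normB _ _) _; rewrite lerD2r.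
rewrite [X in X + _ <= _]normrM [X in _ + X <= _]normrM.
have := ler_pM (normr_ge0 _) (normr_ge0 _) h2 hx.
have := ler_pM (normr_ge0 _) (normr_ge0 _) (ltW iw) hy.
lra.
Qed.

(** The concatenation is indexed by [0, +oo[ and extended by a constant on the
left, so that its continuity is that of a locally Lipschitz function on R. *)
Lemma concat_lip (g : nat -> R -> C) (L : R) :
  (forall n, lip L (g n)) -> (forall n, g n 1 = g n.+1 0) -> 0 <= L ->
  exists2 G : R -> C, continuous G &
    forall n (t : R), 0 <= t <= 1 -> G (n%:R + t) = g n t.
Proof.
move=> lg jg L0.
pose T (x : R) := Num.truncn x.
pose G0 (x : R) := g (T x) (x - (T x)%:R).
have G0E n (t : R) : 0 <= t <= 1 -> G0 (n%:R + t) = g n t.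
  move=> /andP[t0]; rewrite le_eqVlt => /orP[/eqP ->|t1].
    by rewrite natr1 /G0 /T natrK subrr jg.
  have -> : G0 (n%:R + t) = g n (n%:R + t - n%:R).
    rewrite /G0; have -> // : T (n%:R + t) = n.
    by apply: truncn_def; rewrite lerDl t0 -natr1 ltrD2l.
  by congr g; ring.
pose G (x : R) := G0 (Num.max 0 x).
exists G; last first.
  by move=> n t ht; rewrite -(G0E n t ht) /G max_r//; case/andP: ht => t0 _; rewrite addr_ge0.
have decomp (x : R) : 0 <= x -> exists n (t : R), 0 <= t < 1 /\ x = n%:R + t.
  move=> x0; exists (T x), (x - (T x)%:R); split; last by ring.
  have := truncn_itv x0; rewrite -/(T x) -natr1 => /andP[h1 h2].
  by apply/andP; split; lra.
have lipG0 (x y : R) : 0 <= x -> x <= y -> y <= x + 1 -> nrm (G0 y - G0 x) <= L * (y - x).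
  move=> x0 xy y1; have [n [t [/andP[t0 t1] xE]]] := decomp x x0.
  have [yn|yn] := leP y (n%:R + 1).
    have yE : y = n%:R + (y - n%:R) by ring.
    rewrite xE yE !G0E; [|by apply/andP; split; lra|by apply/andP; split; lra].
    apply: le_trans (lg n _ _ _ _) _; try (by apply/andP; split; lra).
    by rewrite ger0_norm; lra.
  have yE : y = n.+1%:R + (y - n.+1%:R) by ring.
  have nS : n.+1%:R = n%:R + 1 :> R by rewrite natr1.
  rewrite xE yE !G0E; [|by apply/andP; split; lra|by apply/andP; split; lra].
  apply: le_trans (nrm_dist _ _ (g n.+1 0)) _; rewrite -{2}jg.
  have h1 : nrm (g n.+1 (y - n.+1%:R) - g n.+1 0) <= L * (y - n.+1%:R).
    apply: le_trans (lg n.+1 _ _ _ _) _; try (by apply/andP; split; lra).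
    by rewrite ger0_norm; lra.
  have h2 : nrm (g n 1 - g n t) <= L * (1 - t).
    apply: le_trans (lg n _ _ _ _) _; try (by apply/andP; split; lra).
    by rewrite ger0_norm; lra.
  by rewrite nS in h1 *; lra.
have lipG (x y : R) : `|y - x| <= 1 -> nrm (G y - G x) <= L * `|y - x|.
  wlog xy : x y / x <= y => [hw|].
    have [/hw|/ltW/hw h] := leP x y; first exact.
    by rewrite nrmB distrC; exact: h.
  rewrite ger0_norm ?subr_ge0// => xy1.
  have : nrm (G y - G x) <= L * (Num.max 0 y - Num.max 0 x).
    by apply: lipG0; case: (leP 0 x) => ?; case: (leP 0 y) => ?; lra.
  move=> h; apply: le_trans h _; rewrite ler_wpM2l//.
  by case: (leP 0 x) => ?; case: (leP 0 y) => ?; lra.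
move=> x; apply/cvg_nrmP => e e0.
have d0 : 0 < Num.min 1 (e / (L + 1)) by rewrite lt_min ltr01 divr_gt0//; lra.
apply/nbhs_ballP; exists (Num.min 1 (e / (L + 1))) => //= y.
rewrite /ball /= distrC lt_min => /andP[h1 h2].
apply: le_lt_trans (lipG _ _ (ltW h1)) _.
rewrite ltr_pdivlMr in h2; last lra.
by have := normr_ge0 (y - x); nra.
Qed.

End Access.

(** * Boundary points with bounded orbit are accessible *)

Section BoundedAccessible.
Variable R : realType.
Local Notation C := (R[i]^o).
Local Notation Re := (@complex.Re R).
Local Notation Im := (@complex.Im R).
Local Notation f := (fbaker R).
Local Notation basin := (@basin R).
Local Notation basept := (@basept R).

(** A curve on [0, +oo[ made of the pullbacks of the crossbars. The corner paths
tie the n-th pullback of the base point to the start of the orbit, and the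
crossbars then tie the curve to it. *)
Lemma coded_access (A : R) (z : nat -> C) (s : nat -> bool) : coded A z s ->
  exists G : R -> C, [/\ continuous G, G 0 = basept%:C,
    (forall T : R, 0 <= T -> basin (G T)) &
    forall e : R, 0 < e -> exists N : nat, forall T : R, N%:R <= T -> nrm (G T - z 0%N) < e].
Proof.
move=> hz; pose L := 2 * (A + `|basept|) + 2 * pi.
have A0 : 0 <= A by have [_ _ _ h] := hz 0%N; exact: le_trans h.
have p0 := pi_gt0 R; have q0 := normr_ge0 basept.
have L0 : 0 <= L by rewrite /L; lra.
have [k k1 hk] := expansion (A + 2 * L).
have kn0 n : 0 < k ^+ n by rewrite exprn_gt0//; lra.
have knL n : L / k ^+ n <= L.
  by rewrite ler_piMr// invf_le1// exprn_ege1// ltW.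
have anchor n z' s' : coded A z' s' -> nrm (pullback s' n basept%:C - z' 0%N) <= L / k ^+ n.
  move=> hz'; have [_ _ on An] := hz' n.
  have := @pullback_lip R A L k k1 L0 hk n z' s' (corner (z' n)) hz' (corner_lip An on)
    (fun t ht => corner_outer ht on) _ 1 0.
  rewrite /= corner0 corner1 (pullback_orbit n hz') subr0 normr1 mulr1 !lexx ler01 /=; apply=> //.
  move=> j jn; have := pullback_orbit (n - j) (coded_shift j hz').
  rewrite /= subnKC// addn0 => ->.
  by rewrite subrr /nrm /= expr0n /= addr0 sqrtr0.
pose g (m : nat) (t : R) := pullback s m (@crossbar R (s m) t).
have lg n : lip (L / k ^+ n) (g n).
  apply: (@pullback_lip R A L k k1 L0 hk n z s (@crossbar R (s n)) hz).
  - by apply: lipW (crossbar_lip _); rewrite /L; lra.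
  - by move=> t; exact: crossbar_outer.
  move=> j jn; rewrite crossbar0; apply: le_trans (knL (n - j)%N).
  by have := anchor (n - j)%N _ _ (coded_shift j hz); rewrite addn0.
have jg n : g n 1 = g n.+1 0 by rewrite /g crossbar1 crossbar0 pullbackSr.
have [G cG hG] := @concat_lip R g L (fun n => lipW (knL n) (lg n)) jg L0.
have close n (t : R) : 0 <= t <= 1 -> nrm (g n t - z 0%N) <= 2 * (L / k ^+ n).
  move=> ht; apply: le_trans (nrm_dist _ _ (g n 0)) _.
  have h1 : nrm (g n 0 - z 0%N) <= L / k ^+ n by rewrite /g crossbar0; exact: anchor.
  have h2 : nrm (g n t - g n 0) <= L / k ^+ n.
    apply: le_trans (lg n t 0 ht _) _; first by rewrite lexx ler01.
    case/andP: ht => t0 t1; rewrite subr0 ger0_norm// ler_piMr// divr_ge0//; exact: ltW.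
  lra.
have decomp (T : R) : 0 <= T -> exists n (t : R), [/\ 0 <= t <= 1, T = n%:R + t & n = Num.truncn T].
  move=> T0; exists (Num.truncn T), (T - (Num.truncn T)%:R); split=> //; last by ring.
  have := truncn_itv T0; rewrite -natr1 => /andP[h1 h2].
  by apply/andP; split; lra.
exists G; split=> //.
- by have := hG 0%N 0; rewrite add0r => ->; rewrite ?lexx ?ler01 // /g crossbar0.
- move=> T /decomp[n [t [ht -> _]]]; rewrite hG//.
  by apply: pullback_basin; [exact: crossbar_outer|exact: crossbar_basin].
move=> e e0.
pose N := (Num.truncn (2 * L / (e * (k - 1)))).+1.
have hN : 2 * L / (e * (k - 1)) < N%:R by rewrite truncnS_gt.
exists N => T NT; have T0 : 0 <= T by apply: le_trans NT.
have [n [t [ht TE nE]]] := decomp T T0; rewrite {1}TE hG//.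
apply: le_lt_trans (close n t ht) _.
have Nn : N%:R <= n%:R :> R by rewrite ler_nat nE truncn_ge_nat.
have bn := bernoulli n k1.
rewrite mulrA ltr_pdivrMr// .
rewrite ltr_pdivrMr in hN; last by rewrite mulr_gt0//; lra.
apply: lt_le_trans hN _.
apply: le_trans (_ : e * (1 + n%:R * (k - 1)) <= _); last by rewrite ler_pM2l.
have h1 : N%:R * (e * (k - 1)) <= n%:R * (e * (k - 1)) by rewrite ler_wpM2r// mulr_ge0//; lra.
lra.
Qed.

Section Domain.
Variable U : set C.
Hypothesis hU : unique (fun V : set C => baker_domain f V /\ V `<=` strip R) U.

(** The lines |y| = pi are excluded because x -> x - e^(- x) has no bounded
orbit there; the real axis and the petal lie in the basin. *)
Lemma bounded_coded v : boundary U v -> bounded_orbit f v ->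
  exists A, coded A (fun n => iter n f v) (fun n => 0 < Im (iter n f v)).
Proof.
move=> bv [M [Mr hM]].
have [B hB] : exists B : R, forall n, nrm (iter n f v) <= B.
  exists (complex.Re M + 1) => n.
  have MM : M < (complex.Re M + 1)%:C.
    by rewrite -(RRe_real Mr) /= ltcR ltrDl.
  have := hM _ MM (iter n f v); rewrite /= normE lecR; apply.
  by exists n.
have nb n : ~ basin (iter n f v) by move/basin_iter; exact: boundary_nbasin hU v bv.
exists B => n.
have rB m : `|Re (iter m f v)| <= B by apply: le_trans (hB m); exact: Re_le_nrm.
have im0 : Im (iter n f v) != 0 by apply/eqP => h; apply: (nb n); exact: real_basin.
have impi : `|Im (iter n f v)| < pi.
  rewrite lt_neqAle (boundary_strip hU n bv) andbT; apply/eqP => e.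
  have line k : `|Im (iter (k + n) f v)| = pi /\
      Re (iter (k + n) f v) <= B - k%:R * expR (- B).
    elim: k => [|k [IH1 IH2]].
      by split=> //; rewrite mul0r subr0; apply: le_trans (rB n); exact: ler_norm.
    have cy : cos (Im (iter (k + n) f v)) = - 1 by rewrite -cos_norm IH1 cospi.
    have sy : sin (Im (iter (k + n) f v)) = 0.
      by apply/eqP; rewrite -sqrf_eq0 sin2cos2 cy sqrrN expr1n subrr.
    rewrite addSn iterS Im_f Re_f /fim /fre sy cy mulr0 subr0; split=> //.
    have : expR (- B) <= expR (- Re (iter (k + n) f v)).
      by rewrite ler_expR lerN2; apply: le_trans (rB _); exact: ler_norm.
    rewrite -natr1; lra.
  pose K := (Num.truncn (2 * B / expR (- B))).+1.
  have hK : 2 * B / expR (- B) < K%:R by rewrite truncnS_gt.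
  rewrite ltr_pdivrMr ?expR_gt0// in hK.
  have [_ h] := line K; have := rB (K + n)%N.
  by rewrite ler_norml => /andP[h1 _]; lra.
split=> //.
- rewrite /halfstrip /upper /=; move: impi; rewrite ltr_norml => /andP[h1 h2].
  have [i0|i0|i0] := ltgtP 0 (Im (iter n f v)).
  + by rewrite h2.
  + by apply/andP; split; lra.
  + by rewrite -i0 eqxx in im0.
split=> //; right; rewrite leNgt; apply/negP => h.
by apply: (nb n); exists 0%N; split.
Qed.

(** The parameter t / (1 - t) maps [0, 1[ onto [0, +oo[. The curve is connected,
lies in the basin and starts on the real axis, so it lies in U. *)
Lemma bounded_accessible v : boundary U v -> bounded_orbit f v -> accessible U v.
Proof.
move=> bv /(bounded_coded bv)[A /coded_access[G [cG G0 bG lG]]].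
pose h (t : R) := t / (1 - t).
have ch (t : R) : t < 1 -> h x @[x --> t] --> h t.
  move=> t1; apply: cvgM; first exact: cvg_id.
  apply: cvgV; first by rewrite gt_eqF// subr_gt0.
  by apply: cvgB; [exact: cvg_cst|exact: cvg_id].
have h0 (t : R) : 0 <= t < 1 -> 0 <= h t by move=> /andP[t0 t1]; rewrite divr_ge0//; lra.
have cg : {within `[0, 1[, continuous (G \o h)}.
  apply: continuous_in_subspaceT => t; rewrite inE /= in_itv /= => /andP[t0 t1].
  by apply: (@cvg_comp _ _ _ h G _ _ _ (ch t t1)); exact: cG.
exists (G \o h); split=> //.
- apply: (domain_absorb hU).
  + apply: connected_continuous_connected => //.
    by apply/connected_intervalP; exact: interval_is_interval.
  + by move=> _ [t /= t01 <-]; apply: bG; apply: h0; move: t01; rewrite in_itv.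
  exists basept%:C; split; last exact: (real_sub_domain hU).
  by exists 0; rewrite /= ?in_itv /= ?lexx ?ltr01// /h mul0r.
apply/cvg_nrmP => e e0; have [N hN] := lG e e0.
have N0 : 0 <= N%:R :> R := ler0n _ _.
near=> t; apply: hN.
have t1 : t < 1 by near: t; exact: nbhs_left_lt.
have tN : N%:R / (N%:R + 1) < t by near: t; apply: nbhs_left_gt; rewrite ltr_pdivrMr; lra.
rewrite ltr_pdivrMr in tN; last lra.
rewrite /h ler_pdivlMr ?subr_gt0//; lra.
Unshelve. all: by end_near. Qed.

End Domain.
End BoundedAccessible.

Theorem theoremC (R : realType) (U : set R[i]^o)
    (hU : unique (fun V : set R[i]^o =>
            baker_domain (fbaker R) V /\ V `<=` strip R) U) :
  (forall v, boundary U v -> escaping (fbaker R) v -> ~ accessible U v) /\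
  (forall v, boundary U v -> bounded_orbit (fbaker R) v -> accessible U v).
Proof.
split; first exact: escaping_not_accessible hU.
exact: bounded_accessible hU.
Qed.
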